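(* Let $M\ge 1$ be an integer, $\alpha,\beta,\omega,A_0,h_l,\bar\gamma,\mathcal R_t>0$ and $c=\frac{e}{2\pi}$. Let the SNRs $\gamma_1,\dots,\gamma_M$ of the $M$ HARQ rounds be independent, each with density $$f_{\gamma}(x)=\frac{\sqrt{\omega}}{2x\,\Gamma(\alpha)\Gamma(\beta)}\,G^{3,0}_{1,3}\!\left(\frac{\alpha\beta}{A_0h_l}\sqrt{\frac{x}{\bar\gamma}}\,\middle|\,\begin{matrix}\omega+\tfrac12\\ \alpha,\ \beta,\ \omega\end{matrix}\right),\qquad x>0 .$$ Then the outage probability of HARQ with incremental redundancy, $$P^{\mathrm{ir}}_{o,M}(\mathcal R_t)=\mathbb P\!\left(\sum_{m=1}^M\log_2(1+c\gamma_m)<2\mathcal R_t\right),$$ satisfies $P^{\mathrm{ir}}_{o,M}(\mathcal R_t)\le P^{\mathrm{ir,ub}}_{o,M}(\mathcal R_t)$, where $$P^{\mathrm{ir,ub}}_{o,M}(\mathcal R_t)=\left(\frac{\sqrt{\omega}}{\Gamma(\alpha)\Gamma(\beta)}\right)^{M}G^{3M,1}_{M+1,3M+1}\!\left(\left(\frac{\alpha\beta}{A_0h_l}\sqrt{\frac{2^{2\mathcal R_t/M}-1}{c\bar\gamma}}\right)^{M}\middle|\,\begin{matrix}1,\ \{\omega+\tfrac12\}_1^M\\ \{\alpha\}_1^M,\ \{\beta\}_1^M,\ \{\omega\}_1^M,\ 0\end{matrix}\right).$$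
   Context: $\{x\}_1^M$ denotes $x$ repeated $M$ times. Meijer $G$-function convention: $G^{m,n}_{p,q}\!\left(x\,\middle|\,\begin{matrix}a_1,\dots,a_p\\ b_1,\dots,b_q\end{matrix}\right)=\frac{1}{2\pi i}\int_L\frac{\prod_{j=1}^m\Gamma(b_j-s)\prod_{j=1}^n\Gamma(1-a_j+s)}{\prod_{j=m+1}^q\Gamma(1-b_j+s)\prod_{j=n+1}^p\Gamma(a_j-s)}x^s\,ds$, where $L$ is a vertical contour (upward) separating the poles of the $\Gamma(b_j-s)$, $j\le m$ (to its right), from those of the $\Gamma(1-a_j+s)$, $j\le n$ (to its left). The function $f_\gamma$ is an approximate density used as if exact (it is nonnegative but need not integrate exactly to $1$); accordingly, $\mathbb P((\gamma_1,\dots,\gamma_M)\in B)$ denotes $\int_B\prod_{m=1}^M f_\gamma(x_m)\,dx_1\cdots dx_M$ for Borel $B\subseteq(0,\infty)^M$. *)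

(* Defs.v *)
From HB Require Import structures.
From mathcomp Require Import all_boot all_order all_algebra.
From mathcomp Require Import all_classical all_reals all_analysis.
From mathcomp Require Import complex.
Import Order.TTheory GRing.Theory Num.Theory.
Import numFieldNormedType.Exports.

Set Implicit Arguments.
Unset Strict Implicit.
Unset Printing Implicit Defensive.

Local Open Scope classical_set_scope.
Local Open Scope ring_scope.
Local Open Scope complex_scope.

Section ComplexIntegral.
Variable R : realType.
Implicit Types (D : set R) (f : R -> R[i]) (z s : R[i]).

Definition cintegral D f : R[i] :=
  (\int[@lebesgue_measure R]_(t in D) complex.Re (f t))
  +i* (\int[@lebesgue_measure R]_(t in D) complex.Im (f t)).

Definition cexp z : R[i] :=
  (expR (complex.Re z))%:C * (cos (complex.Im z) +i* sin (complex.Im z)).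

(* Principal power, meant for x > 0 only. *)
Definition cpow (x : R) s : R[i] := cexp (s * (ln x)%:C).

End ComplexIntegral.

Section Gamma.
Variable R : realType.
Implicit Types z : R[i].

(* Euler's integral, the Gamma function on Re z > 0. *)
Definition Gamma_integral z : R[i] :=
  cintegral `]0, +oo[ (fun t => cpow t (z - 1) * (expR (- t))%:C).

(* The least n with Re z + n > 0. *)
Definition Gamma_shift z : nat :=
  if 0 < complex.Re z then 0%N else (Num.truncn (- complex.Re z)).+1.

(* Continuation by Gamma(z) = Gamma(z + n) / (z (z + 1) ... (z + n - 1)).
   At the poles 0, -1, -2, ... the denominator vanishes and the value is 0;
   hence (Gamma z)^-1 is there 0, the correct value of the entire function
   1/Gamma. *)
Definition Gamma z : R[i] :=
  let n := Gamma_shift z in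
  Gamma_integral (z + n%:R) / \prod_(k < n) (z + k%:R).

End Gamma.

Section MeijerG.
Variable R : realType.
Implicit Types (m n : nat) (a b : seq R) (sigma x : R) (s : R[i]).

(* With a = [:: a_1; ...; a_p] and b = [:: b_1; ...; b_q]; take/drop split the
   parameters into j <= m, j > m (resp. j <= n, j > n). *)
Definition meijerG_integrand m n a b x s : R[i] :=
  (\prod_(c <- take m b) Gamma (c%:C - s))
  * (\prod_(c <- take n a) Gamma (1 - c%:C + s))
  / ((\prod_(c <- drop m b) Gamma (1 - c%:C + s))
     * (\prod_(c <- drop n a) Gamma (c%:C - s)))
  * cpow x s.

(* The line Re s = sigma leaves the poles b_j + k of Gamma(b_j - s), j <= m, to
   its right and the poles a_j - 1 - k of Gamma(1 - a_j + s), j <= n, to its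
   left. *)
Definition separates_poles m n a b sigma : Prop :=
  forall k : nat,
    (forall c, c \in take m b -> sigma < c + k%:R) /\
    (forall c, c \in take n a -> c - 1 - k%:R < sigma).

(* 1/(2 pi i) times the integral of F over s = sigma + i t, t from -oo to +oo,
   ds = i dt. *)
Definition vertical_integral sigma (F : R[i] -> R[i]) : R[i] :=
  ((2 * pi)%:C * 'i)^-1 * cintegral setT (fun t => F (sigma +i* t) * 'i).

(* The abscissa is an arbitrary separating one, on which the value does not
   depend. The function is meaningful when a separating vertical line exists,
   i.e. when a_j - 1 < b_l for all j <= n and l <= m. *)
Definition meijerG m n a b x : R[i] :=
  vertical_integral (xget 0 [set sigma | separates_poles m n a b sigma])
    (meijerG_integrand m n a b x).

End MeijerG.

Section TupleProduct.
Local Open Scope ereal_scope.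
Context d (T : measurableType d) (R : realType) (n : nat).

Definition tcons (p : T * n.-tuple T) : n.+1.-tuple T :=
  [the n.+1.-tuple T of p.1 :: p.2].

Lemma measurable_tcons : measurable_fun [set: T * n.-tuple T] tcons.
Proof. exact: measurable_cons. Qed.

Definition tuncons (t : n.+1.-tuple T) : T * n.-tuple T :=
  (thead t, [tuple of behead t]).

Lemma measurable_tuncons : measurable_fun [set: n.+1.-tuple T] tuncons.
Proof.
apply: measurable_fun_pair; [exact: measurable_tnth|exact: measurable_behead].
Qed.

Lemma tconsK : cancel tcons tuncons.
Proof. by case=> x t; congr (_, _); exact/val_inj. Qed.

Variables (m1 : {sigma_finite_measure set T -> \bar R})
  (m2 : {sigma_finite_measure set (n.-tuple T) -> \bar R}).

(* The product measure m1 x m2, transported to (n+1)-tuples. *)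
Definition tcons_measure : set (n.+1.-tuple T) -> \bar R :=
  pushforward (m1 \x m2) tcons.

Let tcons_measure0 : tcons_measure set0 = 0.
Proof. by rewrite /tcons_measure /pushforward preimage_set0 measure0. Qed.

Let tcons_measure_ge0 A : 0 <= tcons_measure A.
Proof. by rewrite /tcons_measure /pushforward; apply: (measure_ge0 (m1 \x m2)). Qed.

Let mpre A : measurable A -> measurable (tcons @^-1` A).
Proof. by move=> mA; rewrite -[X in measurable X]setTI; exact: measurable_tcons. Qed.

Let tcons_measure_sigma_additive : semi_sigma_additive tcons_measure.
Proof.
move=> F mF tF mUF; rewrite /tcons_measure /pushforward preimage_bigcup.
apply: measure_semi_sigma_additive.
- by move=> k; exact: mpre.
- apply/trivIsetP => /= i j _ _ ij; rewrite -preimage_setI.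
  by move/trivIsetP : tF => /(_ _ _ _ _ ij) ->//; rewrite preimage_set0.
- by rewrite -preimage_bigcup; exact: mpre.
Qed.

HB.instance Definition _ := isMeasure.Build _ _ _ tcons_measure
  tcons_measure0 tcons_measure_ge0 tcons_measure_sigma_additive.

Let tcons_measure_sigma_finite : sigma_finite setT tcons_measure.
Proof.
have /sigma_finiteP[F [TF ndF Foo]] := sigma_finiteT m1.
have /sigma_finiteP[G [TG ndG Goo]] := sigma_finiteT m2.
exists (fun k => tuncons @^-1` (F k `*` G k)).
  rewrite -preimage_bigcup; apply/seteqP; split=> // t _ /=.
  have [k _ Fk] : (\bigcup_k F k) (thead t) by rewrite -TF.
  have [l _ Gl] : (\bigcup_k G k) [tuple of behead t] by rewrite -TG.
  exists (maxn k l) => //; split => /=.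
  - by move: Fk; exact/subsetPset/ndF/leq_maxl.
  - by move: Gl; exact/subsetPset/ndG/leq_maxr.
move=> k; have [mF Fk] := Foo k; have [mG Gk] := Goo k; split.
  by rewrite -[X in measurable X]setTI; apply: measurable_tuncons => //;
    exact: measurableX.
rewrite /tcons_measure /pushforward -comp_preimage.
rewrite (_ : _ \o _ = id) ?preimage_id//; last first.
  by apply/funext => p; exact: tconsK.
by rewrite product_measure1E// lte_mul_pinfty// ge0_fin_numE.
Qed.

HB.instance Definition _ := Measure_isSigmaFinite.Build _ _ _ tcons_measure
  tcons_measure_sigma_finite.

End TupleProduct.

Section Outage.
Variable R : realType.

Local Notation mR := (measurableTypeR R).

(* Lebesgue measure on R^n. *)
Fixpoint lebesgue_tuple n :
    {sigma_finite_measure set (n.-tuple mR) -> \bar R} :=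
  match n with
  | 0 => dirac [tuple]
  | n'.+1 => tcons_measure (@lebesgue_measure R) (lebesgue_tuple n')
  end.

(* For real parameters and x > 0 the integrand of meijerG at the conjugate of s
   is the conjugate of its value at s, so that the complex numbers whose real
   part is taken in snr_density and outage_ir_ub are real. *)
Definition snr_density (alpha beta omega A0 hl gbar x : R) : R :=
  complex.Re
    ((Num.sqrt omega)%:C
     / ((2 * x)%:C * Gamma alpha%:C * Gamma beta%:C)
     * meijerG 3 0 [:: omega + 2^-1] [:: alpha; beta; omega]
         (alpha * beta / (A0 * hl) * Num.sqrt (x / gbar))).

(* The integral over B of f x_1 ... f x_M dx_1 ... dx_M; f need not integrate
   to 1. *)
Definition prob_iid M (f : R -> R) (B : set (M.-tuple mR)) : \bar R :=
  (\int[lebesgue_tuple M]_(x in B) (\prod_(m < M) f (tnth x m))%:E)%E.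

Definition log2 (y : R) : R := ln y / ln 2.

Definition capacity_const : R := expR 1 / (2 * pi).

Definition outage_ir M (alpha beta omega A0 hl gbar Rt : R) : \bar R :=
  prob_iid (snr_density alpha beta omega A0 hl gbar)
    [set x : M.-tuple mR |
      (forall m : 'I_M, 0 < tnth x m) /\
      \sum_(m < M) log2 (1 + capacity_const * tnth x m) < 2 * Rt].

Definition outage_ir_ub M (alpha beta omega A0 hl gbar Rt : R) : R :=
  complex.Re
    (((Num.sqrt omega)%:C / (Gamma alpha%:C * Gamma beta%:C)) ^+ M
     * meijerG (3 * M) 1
         (1 :: nseq M (omega + 2^-1))
         (nseq M alpha ++ nseq M beta ++ nseq M omega ++ [:: 0])
         ((alpha * beta / (A0 * hl)
           * Num.sqrt ((2 `^ (2 * Rt / M%:R) - 1) / (capacity_const * gbar)))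
          ^+ M)).

End Outage.

(* Main.v *)
(* All positive variables are written x = e^v, so that Mellin transforms become
   Fourier transforms on vertical lines and products become sums.  The function
   G^{3,0}_{1,3} is the multiplicative convolution of the two Gamma densities
   x^alpha e^{-x} and x^beta e^{-x} with a Beta(omega, 1/2) density, whose
   Mellin transform is Gamma(omega - s) / Gamma(omega + 1/2 - s); in particular
   it is nonnegative.  A single contour integral has to be computed, the
   Cahen-Mellin inversion x^a e^{-x} = 1/(2 pi i) int Gamma(a - s) x^s ds, by
   Poisson (Abel) regularization, the absolute convergence coming from the
   functional equation; every further convolution with a nonnegative kernel
   multiplies the integrand by the Mellin transform of the kernel, by Fubini.
   Convolving with the indicator of (0, 1) contributes the factor
   1/s = Gamma(s)/Gamma(1 + s), so that the integral of the product density over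
   {prod x_m < X} is exactly the Meijer function of the bound.  Finally
   y |-> ln (1 + c e^y) is convex, so the outage event is contained in
   {prod x_m < X} with X = ((2^{2 R_t / M} - 1) / c)^M. *)
Require Import Defs.
From HB Require Import structures.
From mathcomp Require Import all_boot all_order all_algebra.
From mathcomp Require Import all_classical all_reals all_analysis.
From mathcomp Require Import complex.
From mathcomp Require Import measurable_realfun ring lra.
Import Order.TTheory GRing.Theory Num.Theory.
Import numFieldNormedType.Exports.

Set Implicit Arguments.
Unset Strict Implicit.
Unset Printing Implicit Defensive.

Local Open Scope classical_set_scope.
Local Open Scope ring_scope.

(** * Complex-valued integrals on the real line *)

(** The abscissa in [meijerG] is whatever [xget] returns, so no convenient contour can be chosen:
    [inversion_at s] is established at every admissible [s], by tilting with [expR (- s * v)], and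
    no contour is ever shifted. A decay estimate is made only once, for a single Gamma factor, where
    two steps of the functional equation give quadratic decay; each convolution then preserves
    integrability by Fubini, without asymptotics of Gamma. Quotients of Gamma factors must be
    cancelled, both for the Beta kernel and in [Gamma s / Gamma (1 + s)], so Gamma has to be nonzero
    on the right half-plane; an estimate for large real part, carried to the left by the functional
    equation, gives this. Real integrals are values of [fine], which sends infinity to 0; densities
    therefore carry pointwise bounds that keep every convolution integral finite at every point. *)

Ltac meas := repeat first
  [ assumption | exact: measurable_cst | exact: measurable_id
  | exact: measurable_fst | exact: measurable_snd
  | apply: measurable_funM | apply: measurable_funB | apply: measurable_funD
  | apply: measurable_funN | apply: measurable_funX
  | apply: (measurableT_comp (@measurable_expR _))
  | apply: (measurableT_comp (@measurable_ln _))
  | apply: (measurableT_comp (@normr_measurable _ _)) ].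

Section ComplexBasics.
Variable R : realType.
Implicit Types (z w : R[i]) (x y : R).

Local Notation Re := (@complex.Re R).
Local Notation Im := (@complex.Im R).
Local Notation normc := (@ComplexField.Normc.normc R).

Lemma complexP z w : Re z = Re w -> Im z = Im w -> z = w.
Proof. by case: z w => a b [c d] /= -> ->. Qed.

Lemma ReD z w : Re (z + w) = Re z + Re w. Proof. by case: z w => a b []. Qed.
Lemma ImD z w : Im (z + w) = Im z + Im w. Proof. by case: z w => a b []. Qed.
Lemma ReN z : Re (- z) = - Re z. Proof. by case: z. Qed.
Lemma ImN z : Im (- z) = - Im z. Proof. by case: z. Qed.
Lemma ReM z w : Re (z * w) = Re z * Re w - Im z * Im w.
Proof. by case: z w => a b []. Qed.
Lemma ImM z w : Im (z * w) = Re z * Im w + Im z * Re w.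
Proof. by case: z w => a b []. Qed.
Lemma ReC x : Re x%:C%C = x. Proof. by []. Qed.
Lemma ImC x : Im x%:C%C = 0. Proof. by []. Qed.

Definition ReImE := (ReD, ImD, ReN, ImN, ReM, ImM, ReC, ImC).

Lemma normc_real x : 0 <= x -> normc x%:C%C = x.
Proof. by move=> x0 /=; rewrite expr0n addr0 sqrtr_sqr ger0_norm. Qed.

Lemma normc_ge0 z : 0 <= normc z.
Proof. by case: z => a b /=; exact: sqrtr_ge0. Qed.

Lemma Re_le_normc z : `|Re z| <= normc z.
Proof.
by case: z => a b /=; rewrite -[leLHS]sqrtr_sqr ler_wsqrtr// lerDl sqr_ge0.
Qed.

Lemma Im_le_normc z : `|Im z| <= normc z.
Proof.
by case: z => a b /=; rewrite -[leLHS]sqrtr_sqr ler_wsqrtr// lerDr sqr_ge0.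
Qed.

Lemma normc_le_ReIm z : normc z <= `|Re z| + `|Im z|.
Proof.
case: z => a b /=; rewrite -[leRHS]ger0_norm ?addr_ge0// -[leRHS]sqrtr_sqr.
rewrite ler_wsqrtr// sqrrD !real_normK ?num_real// addrAC lerDl.
by rewrite mulrn_wge0// mulr_ge0.
Qed.

Lemma cexpE z : cexp z =
  ((expR (Re z) * cos (Im z)) +i* (expR (Re z) * sin (Im z)))%C.
Proof. by rewrite /cexp; apply: complexP => /=; rewrite ?mul0r ?subr0 ?addr0. Qed.

Lemma cexpD z w : cexp (z + w) = cexp z * cexp w.
Proof.
rewrite !cexpE; apply: complexP;
  by rewrite /= !ReImE/= expRD (cosD, sinD); ring.
Qed.

Lemma cexp_real x : cexp x%:C%C = (expR x)%:C%C.
Proof. by rewrite cexpE /= cos0 sin0 mulr1 mulr0. Qed.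

Lemma normc_cexp z : normc (cexp z) = expR (Re z).
Proof.
by rewrite cexpE/= !exprMn -mulrDr cos2Dsin2 mulr1 sqrtr_sqr ger0_norm// expR_ge0.
Qed.

Lemma cexp0 : cexp (0 : R[i]) = 1.
Proof. by rewrite (_ : 0 = 0%:C%C)// cexp_real expR0. Qed.

Lemma realcD x y : (x + y)%:C%C = x%:C%C + y%:C%C :> R[i].
Proof. exact: rmorphD. Qed.
Lemma realcB x y : (x - y)%:C%C = x%:C%C - y%:C%C :> R[i].
Proof. exact: rmorphB. Qed.
Lemma realcM x y : (x * y)%:C%C = x%:C%C * y%:C%C :> R[i].
Proof. exact: rmorphM. Qed.
Lemma realcV x : (x^-1)%:C%C = x%:C%C^-1 :> R[i].
Proof. exact: fmorphV. Qed.

End ComplexBasics.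

Definition cmeasurable d (T : measurableType d) (R : realType) (f : T -> R[i]) :=
  measurable_fun setT (fun x => complex.Re (f x)) /\
  measurable_fun setT (fun x => complex.Im (f x)).

Section ComplexMeasurable.
Context d (T : measurableType d) (R : realType).
Implicit Types (f g : T -> R[i]) (h : T -> R).

Lemma cmeasurable_cst (z : R[i]) : cmeasurable (fun _ : T => z).
Proof. by split; exact: measurable_cst. Qed.

Lemma cmeasurable_real h : measurable_fun setT h ->
  cmeasurable (fun x => (h x)%:C%C).
Proof. by move=> mh; split => //=; exact: measurable_cst. Qed.

Lemma cmeasurableM f g : cmeasurable f -> cmeasurable g ->
  cmeasurable (fun x => f x * g x).
Proof.
move=> [fr fi] [gr gi]; split.
- under eq_fun do rewrite ReM.
  by apply: measurable_funB; exact: measurable_funM.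
- under eq_fun do rewrite ImM.
  by apply: measurable_funD; exact: measurable_funM.
Qed.

Lemma cmeasurable_cexp f : cmeasurable f -> cmeasurable (fun x => cexp (f x)).
Proof.
move=> [fr fi]; have me : measurable_fun setT (fun x => expR (complex.Re (f x))).
  by apply: measurableT_comp => //; exact: measurable_expR.
split; under eq_fun do rewrite cexpE/=; apply: measurable_funM => //.
- apply: (measurableT_comp (f := @cos R)) => //.
  by apply: continuous_measurable_fun; exact: continuous_cos.
- apply: (measurableT_comp (f := @sin R)) => //.
  by apply: continuous_measurable_fun; exact: continuous_sin.
Qed.

Lemma cmeasurable_complex h k : measurable_fun setT h -> measurable_fun setT k ->
  cmeasurable (fun x : T => (h x +i* k x)%C).
Proof. by []. Qed.

Lemma cmeasurable_comp d' (T' : measurableType d') f (k : T' -> T) :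
  cmeasurable f -> measurable_fun setT k -> cmeasurable (fun x => f (k x)).
Proof.
by move=> [fr fi] mk; split; [exact: (measurableT_comp fr)|
  exact: (measurableT_comp fi)].
Qed.

End ComplexMeasurable.

Section RealLineIntegral.
Variable R : realType.
Local Notation mR := (measurableTypeR R).
Local Notation mu := (@lebesgue_measure R).
Implicit Types (f : R -> R[i]) (g : R -> R).

Definition integ g := mu.-integrable setT (EFin \o g).
Definition Cint f : R[i] := cintegral setT f.
Definition cinteg f := integ (fun x => complex.Re (f x)) /\
  integ (fun x => complex.Im (f x)).

Lemma integ_measurable g : integ g -> measurable_fun [set: mR] g.
Proof. by move=> /integrableP[/measurable_EFinP]. Qed.

Lemma integ_le g g' : measurable_fun [set: mR] g -> integ g' ->
  (forall x, `|g x| <= g' x) -> integ g.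
Proof.
move=> mg ig' gg'; apply: le_integrable ig' => //=; first exact/measurable_EFinP.
by move=> x _; rewrite lee_fin (le_trans (gg' x))// ler_norm.
Qed.

Lemma integ_normr g : integ g -> integ (fun x => `|g x|).
Proof. by move=> ig; exact: integrable_norm. Qed.

Lemma integD g g' : integ g -> integ g' -> integ (fun x => g x + g' x).
Proof. by move=> ig ig'; exact: (integrableD measurableT ig ig'). Qed.

Lemma integB g g' : integ g -> integ g' -> integ (fun x => g x - g' x).
Proof. by move=> ig ig'; exact: (integrableB measurableT ig ig'). Qed.

Lemma integZ a g : integ g -> integ (fun x => a * g x).
Proof. by move=> ig; exact: (integrableZl measurableT a ig). Qed.

Lemma integP g : measurable_fun [set: mR] g -> (forall x, 0 <= g x) ->
  integ g <-> (\int[mu]_x (g x)%:E < +oo)%E.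
Proof.
move=> mg g0; split=> [/integrableP[_]|h].
  by under eq_integral do rewrite /= ger0_norm//.
apply/integrableP; split; first exact/measurable_EFinP.
by under eq_integral do rewrite /= ger0_norm//.
Qed.

Lemma cinteg_measurable f : cinteg f -> cmeasurable (f : mR -> R[i]).
Proof. by move=> [/integ_measurable ? /integ_measurable ?]. Qed.

Lemma cinteg_le f g : cmeasurable (f : mR -> R[i]) -> integ g ->
  (forall x, ComplexField.Normc.normc (f x) <= g x) -> cinteg f.
Proof.
move=> [fr fi] ig fg; split; apply: (integ_le _ ig) => // x.
- exact: le_trans (Re_le_normc _) (fg x).
- exact: le_trans (Im_le_normc _) (fg x).
Qed.

Lemma integ_normc f : cinteg f ->
  integ (fun x => ComplexField.Normc.normc (f x)).
Proof.
move=> [fr fi]; apply: (integ_le _ (integD (integ_normr fr) (integ_normr fi))).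
  have mr := integ_measurable fr; have mi := integ_measurable fi.
  rewrite (_ : (fun x => _) = fun x => Num.sqrt (complex.Re (f x) ^+ 2 +
      complex.Im (f x) ^+ 2)).
    apply: (measurableT_comp (f := @Num.sqrt R)) => //.
      by apply: continuous_measurable_fun; exact: sqrt_continuous.
    by apply: measurable_funD; exact: measurable_funX.
  by apply/funext => x; case: (f x).
move=> x; rewrite ger0_norm ?normc_ge0//; exact: normc_le_ReIm.
Qed.

Lemma eq_Cint f f' : f =1 f' -> Cint f = Cint f'.
Proof. by move=> ff'; congr Cint; exact/funext. Qed.

Lemma Cint_real g : Cint (fun x => (g x)%:C%C) = (\int[mu]_x g x)%:C%C.
Proof.
by apply: complexP => //=; rewrite /Rintegral integral0_eq.
Qed.

Lemma CintZ z f : cinteg f -> Cint (fun x => z * f x) = z * Cint f.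
Proof.
move=> [fr fi]; apply: complexP => /=.
- rewrite ReM/= -RintegralZl// -RintegralZl// -RintegralB//.
  + by apply: eq_Rintegral => x _; rewrite ReM.
  + exact: integZ.
  + exact: integZ.
- rewrite ImM/= -RintegralZl// -RintegralZl// -RintegralD//.
  + by apply: eq_Rintegral => x _; rewrite ImM.
  + exact: integZ.
  + exact: integZ.
Qed.

(** The factor 2 comes from bounding the real and imaginary parts separately; only boundedness
    matters in [Gamma_decay]. *)
Lemma normc_Cint f g : cinteg f -> integ g ->
  (forall x, ComplexField.Normc.normc (f x) <= g x) ->
  ComplexField.Normc.normc (Cint f) <= 2 * \int[mu]_x g x.
Proof.
move=> [fr fi] ig fg; rewrite (le_trans (normc_le_ReIm _))//= mulr_natl mulr2n.
apply: lerD; apply: (le_trans (le_normr_Rintegral _ _)) => //;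
  apply: le_Rintegral => //.
- exact: integ_normr.
- by move=> x _; exact: le_trans (Re_le_normc _) (fg x).
- exact: integ_normr.
- by move=> x _; exact: le_trans (Im_le_normc _) (fg x).
Qed.

(** Supplies the finiteness hypothesis of the Fubini lemmas below when the dominating function is a
    product. *)
Lemma integral_tensor_lty (p q : R -> R) : integ p -> integ q ->
  (forall x, 0 <= p x) -> (forall x, 0 <= q x) ->
  (\int[mu]_x \int[mu]_y (p x * q y)%:E < +oo)%E.
Proof.
move=> ip iq p0 q0; have mp := integ_measurable ip.
rewrite (eq_integral (fun x : mR => (\int[mu]_y q y * p x)%:E)).
  have /integrableP[_] := integZ (\int[mu]_y q y) ip.
  apply: le_lt_trans; apply: ge0_le_integral => //=.
  - by move=> x _; rewrite lee_fin mulr_ge0// Rintegral_ge0.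
  - by apply/measurable_EFinP; meas.
  - by apply/measurable_EFinP; meas.
  - by move=> x _; rewrite lee_fin ler_norm.
move=> x _; rewrite -[LHS]fineK; last exact: (integrable_fin_num _ (integZ (p x) iq)).
by rewrite -[fine _]/(\int[mu]_y (p x * q y)) RintegralZl// mulrC.
Qed.

End RealLineIntegral.

(** * Fubini for complex integrands under a dominating function *)

Section LineFubini.
Variable R : realType.
Local Notation mR := (measurableTypeR R).
Local Notation mu := (@lebesgue_measure R).
Variables G : mR * mR -> R.
Hypothesis mG : measurable_fun [set: mR * mR] G.
Hypothesis G1 : forall x, integ (fun y => G (x, y)).
Hypothesis G2 : forall y, integ (fun x => G (x, y)).
Hypothesis Goo : (\int[mu]_x \int[mu]_y (G (x, y))%:E < +oo)%E.

Section RealFubini.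
Variable f : mR * mR -> R.
Hypothesis mf : measurable_fun [set: mR * mR] f.
Hypothesis fG : forall z, `|f z| <= G z.

Let m1 x : measurable_fun [set: mR] (fun y => f (x, y)).
Proof. exact: (measurableT_comp mf). Qed.

Let m2 y : measurable_fun [set: mR] (fun x => f (x, y)).
Proof. exact: (measurableT_comp mf). Qed.

Let i1 x : integ (fun y => f (x, y)).
Proof. by apply: integ_le (G1 x) _. Qed.

Let i2 y : integ (fun x => f (x, y)).
Proof. by apply: integ_le (G2 y) _. Qed.

Let if_ : (mu \x mu)%E.-integrable setT (EFin \o f).
Proof.
apply/integrable12ltyP; first exact/measurable_EFinP.
apply: le_lt_trans Goo; apply: ge0_le_integral => //=.
- by move=> x _; exact: integral_ge0.
- apply: (measurable_fun_fubini_tonelli_F (fun z => `|f z|%:E)) => //=.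
  by apply/measurable_EFinP; exact: measurableT_comp.
- apply: (measurable_fun_fubini_tonelli_F (EFin \o G)).
    exact/measurable_EFinP.
  by move=> z; rewrite lee_fin (le_trans _ (fG _)).
- move=> x _; apply: ge0_le_integral => //=.
  + by apply/measurable_EFinP; exact: measurableT_comp.
  + by apply/measurable_EFinP; exact: (integ_measurable (G1 x)).
  + by move=> y _; rewrite lee_fin.
Qed.

Let e1 x : (\int[mu]_y f (x, y))%:E = (\int[mu]_y (f (x, y))%:E)%E.
Proof. by rewrite fineK//; exact: (integrable_fin_num _ (i1 x)). Qed.

Let e2 y : (\int[mu]_x f (x, y))%:E = (\int[mu]_x (f (x, y))%:E)%E.
Proof. by rewrite fineK//; exact: (integrable_fin_num _ (i2 y)). Qed.

(** Passing from [fine] to extended integrals needs the inner integrals finite at every point, not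
    just almost everywhere; hence [G1] and [G2] control every section. *)
Lemma Rintegral_fubini :
  \int[mu]_x \int[mu]_y f (x, y) = \int[mu]_y \int[mu]_x f (x, y).
Proof.
rewrite /Rintegral; congr fine.
under eq_integral do rewrite e1; under [RHS]eq_integral do rewrite e2.
exact: (Fubini if_).
Qed.

Lemma integ_fubini : integ (fun x => \int[mu]_y f (x, y)).
Proof.
rewrite /integ (_ : EFin \o _ = (fun x => \int[mu]_y (f (x, y))%:E)%E).
  exact: (integrable_fubini_F if_).
by apply/funext => x /=; exact: e1.
Qed.

End RealFubini.

Variable f : mR * mR -> R[i].
Hypothesis mf : cmeasurable f.
Hypothesis fG : forall z, ComplexField.Normc.normc (f z) <= G z.

Let fGr z : `|complex.Re (f z)| <= G z.
Proof. exact: le_trans (Re_le_normc _) (fG z). Qed.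
Let fGi z : `|complex.Im (f z)| <= G z.
Proof. exact: le_trans (Im_le_normc _) (fG z). Qed.

Lemma Cint_fubini :
  Cint (fun x => Cint (fun y => f (x, y))) =
  Cint (fun y => Cint (fun x => f (x, y))).
Proof.
apply: complexP => /=.
- exact: (Rintegral_fubini mf.1 fGr).
- exact: (Rintegral_fubini mf.2 fGi).
Qed.

Lemma cinteg_fubini : cinteg (fun x => Cint (fun y => f (x, y))).
Proof. by split; [exact: (integ_fubini mf.1 fGr)|exact: (integ_fubini mf.2 fGi)]. Qed.

End LineFubini.

(** * Affine and exponential substitutions *)

Section Substitution.
Variable R : realType.
Local Notation mR := (measurableTypeR R).
Local Notation mu := (@lebesgue_measure R).

Section Affine.
Variables a b : R.
Hypothesis a0 : 0 < a.

Let phi : mR -> mR := fun x => a * x + b.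

Let mphi : measurable_fun [set: mR] phi.
Proof.
apply: measurable_funD; last exact: measurable_cst.
by apply: measurable_funM => //; exact: measurable_cst.
Qed.

Let m : {measure set mR -> \bar R} := mscale (NngNum (ltW a0))
  (measure_function_pushforward__canonical__measure_function_Measure mu mphi).

(** Lebesgue measure is determined by its values on the intervals []c, d]]; the preimage of such an
    interval under [phi] has length [(d - c) / a], and [mscale] restores the factor [a]. *)
Let affine_measure (A : set mR) : measurable A -> mu A = m A.
Proof.
move=> mA; apply: (@lebesgue_measure_unique R m) => // _ [[c d] _ <-].
rewrite /m /= /mscale /= /pushforward/=.
have -> : phi @^-1` `]c, d] = `](c - b) / a, (d - b) / a]%classic :> set mR.
  apply/seteqP; split => x /=; rewrite !in_itv/= /phi ltr_pdivrMr// ler_pdivlMr//;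
    rewrite ltrBlDr lerBrDr ![x * a]mulrC//.
rewrite !lebesgue_measure_itv/= !lte_fin ltr_pM2r ?invr_gt0// ltrD2r.
case: ifP => _; last by rewrite mule0.
rewrite -!EFinB -EFinM; congr EFin; field; exact: lt0r_neq0.
Qed.

Lemma ge0_integral_affine (g : R -> \bar R) : measurable_fun [set: mR] g ->
  (forall x, 0 <= g x)%E ->
  (\int[mu]_x g x = a%:E * \int[mu]_x g (a * x + b)%R)%E.
Proof.
move=> mg g0; rewrite (@eq_measure_integral _ _ _ _ m mu)/=; last first.
  by move=> A mA _; exact: affine_measure.
rewrite ge0_integral_mscale//=; congr (_ * _)%E.
by rewrite ge0_integral_pushforward.
Qed.

End Affine.

Lemma ge0_integral_translate b (g : R -> \bar R) : measurable_fun [set: mR] g ->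
  (forall x, 0 <= g x)%E -> (\int[mu]_x g (x + b)%R = \int[mu]_x g x)%E.
Proof.
move=> mg g0; rewrite [RHS](ge0_integral_affine b ltr01)// mul1e.
by apply: eq_integral => x _; rewrite mul1r.
Qed.

Lemma ge0_integral_reflect b (g : R -> \bar R) : measurable_fun [set: mR] g ->
  (forall x, 0 <= g x)%E -> (\int[mu]_x g (b - x)%R = \int[mu]_x g x)%E.
Proof.
move=> mg g0; rewrite -(ge0_integral_translate b (g := g))//.
have mgb : measurable_fun [set: mR] (fun x : mR => g (x + b)).
  by apply: (measurableT_comp mg); meas.
rewrite [RHS](@eq_measure_integral _ _ _ _ (pushforward mu (-%R : mR -> mR)))/=.
  rewrite ge0_integral_pushforward//=.
  by apply: eq_integral => x _; rewrite addrC.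
by move=> A mA _; rewrite lebesgue_measureN.
Qed.

Lemma integral_translate b (g : R -> \bar R) : measurable_fun [set: mR] g ->
  (\int[mu]_x g (x + b)%R = \int[mu]_x g x)%E.
Proof.
move=> mg; rewrite integralE [RHS]integralE.
rewrite -(ge0_integral_translate b (g := g^\+%E))//; last exact: measurable_funepos.
rewrite -(ge0_integral_translate b (g := g^\-%E))//; last exact: measurable_funeneg.
by congr (_ - _)%E; apply: eq_integral => x _; rewrite ?funeposE ?funenegE.
Qed.

Lemma Rintegral_translate b (g : R -> R) : measurable_fun [set: mR] g ->
  \int[mu]_x g (x + b) = \int[mu]_x g x.
Proof.
move=> mg; congr fine; apply: (@integral_translate b (EFin \o g)).
exact/measurable_EFinP.
Qed.

Lemma Cint_translate b (f : R -> R[i]) : cmeasurable (f : mR -> _) ->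
  Cint (fun x => f (x + b)) = Cint f.
Proof.
move=> [mr mi]; apply: complexP => /=.
- exact: (@Rintegral_translate b (fun x => complex.Re (f x))).
- exact: (@Rintegral_translate b (fun x => complex.Im (f x))).
Qed.

Lemma integ_translate b (g : R -> R) : integ g -> integ (fun x => g (x + b)).
Proof.
move=> ig; have mg := integ_measurable ig.
have mgb : measurable_fun [set: mR] (fun x : mR => g (x + b)).
  by apply: (measurableT_comp mg); meas.
apply/integrableP; split; first exact/measurable_EFinP.
rewrite (@ge0_integral_translate b (fun x => `|(g x)%:E|)%E)//.
  by case/integrableP : ig.
by apply: measurableT_comp => //; exact/measurable_EFinP.
Qed.

Lemma measurable_gt0 : measurable_fun [set: mR] (fun x : mR => (0 < x)%R%:R : R).
Proof.
rewrite (_ : (fun x => _) = \1_(`]0, +oo[ : set mR)).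
  by apply: measurable_indic; exact: measurable_itv.
apply/funext => x; rewrite indicE; congr (_%:R); congr nat_of_bool.
by apply/idP/idP; rewrite inE/= in_itv/= andbT.
Qed.

Lemma integral_gt0 (g : R -> R) :
  (\int[mu]_(x in `]0%R, +oo[) (g x)%:E = \int[mu]_x ((0 < x)%R%:R * g x)%:E)%E.
Proof.
rewrite integral_mkcond; apply: eq_integral => x _;
  rewrite patchE mem_setE in_itv/= andbT.
by case: ifP => _; rewrite ?mul1r ?mul0r.
Qed.

Lemma integral_inv (a b : R) : 0 < a -> a < b ->
  (\int[mu]_(x in `[a, b]) (x^-1)%:E = (ln b - ln a)%:E)%E.
Proof.
move=> a0 ab; rewrite (continuous_FTC2 (F := @ln R))//.
- apply: continuous_in_subspaceT => x; rewrite inE/= in_itv/= => /andP[ax _].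
  by apply: inv_continuous; rewrite gt_eqF// (lt_le_trans a0).
- split.
  + move=> x; rewrite in_itv/= => /andP[ax _].
    by apply: ex_derive; apply: is_derive1_ln; rewrite (lt_trans a0).
  + by apply: cvg_at_right_filter; apply: continuous_ln.
  + by apply: cvg_at_left_filter; apply: continuous_ln; rewrite (lt_trans a0).
- move=> x; rewrite in_itv/= => /andP[ax _]; rewrite derive1E.
  by apply: derive_val; apply: is_derive1_ln; rewrite (lt_trans a0).
Qed.

(* G |-> int_{x > 0} G (ln x) dx / x is invariant under translations of G, hence
   by Tonelli proportional to the Lebesgue integral; the constant is found on the
   indicator h of (0, 1]. *)
Lemma ge0_integral_expR (g : R -> R) : measurable_fun [set: mR] g ->
  (forall x, 0 <= g x) ->
  (\int[mu]_(x in `]0%R, +oo[) (g x)%:E = \int[mu]_v (expR v * g (expR v))%:E)%E.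
Proof.
move=> mg g0; pose p (x : mR) : R := (0 < x)%R%:R.
pose h (v : mR) : R := \1_(`]0, 1] : set mR) v.
have p0 x : 0 <= p x by rewrite ler0n.
have h0 x : 0 <= h x by rewrite /h indicE ler0n.
have mp : measurable_fun [set: mR] p by exact: measurable_gt0.
have mh : measurable_fun [set: mR] h.
  by apply: measurable_indic; exact: measurable_itv.
have mge : measurable_fun [set: mR] (fun x : mR => g (expR x)).
  by apply: (measurableT_comp mg); exact: measurable_expR.
rewrite integral_gt0; set I := (LHS).
have I0 : (0 <= I)%E by apply: integral_ge0 => x _; rewrite lee_fin mulr_ge0.
have h1 : (\int[mu]_v (h v)%:E = 1)%E.
  rewrite /h integral_indic// setIT; have := @lebesgue_measure_itv R `]0, 1].
  by rewrite /= lte_fin ltr01 sube0.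
have scale v : (I = \int[mu]_x (p x * (expR v * g (expR v * x)))%:E)%E.
  rewrite /I (ge0_integral_affine 0 (expR_gt0 v))//; last 2 first.
    by apply/measurable_EFinP; meas.
    by move=> x; rewrite lee_fin mulr_ge0.
  rewrite -ge0_integralZl ?lee_fin ?expR_ge0//; last 2 first.
    apply/measurable_EFinP; apply: (measurableT_comp (f := fun x => p x * g x)).
      by meas.
    by meas.
    by move=> x _; rewrite lee_fin mulr_ge0.
  apply: eq_integral => x _; rewrite -EFinM addr0 /p pmulr_rgt0 ?expR_gt0//.
  by congr EFin; ring.
transitivity (\int[mu]_v \int[mu]_x
    (h v * (p x * (expR v * g (expR v * x))))%:E)%E.
  rewrite -[LHS]mule1 -h1 -ge0_integralZl//; last 2 first.
    exact/measurable_EFinP.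
    by move=> x _; rewrite lee_fin.
  apply: eq_integral => v _; rewrite muleC [in LHS](scale v) -ge0_integralZl//.
  - apply/measurable_EFinP; meas; apply: (measurableT_comp mg); meas.
  - by move=> x _; rewrite lee_fin !mulr_ge0 ?expR_ge0.
  - by rewrite lee_fin.
rewrite (@fubini_tonelli _ _ _ _ _ mu mu
  (fun z : mR * mR => (h z.1 * (p z.2 * (expR z.1 * g (expR z.1 * z.2))))%:E))/=;
  last 2 first.
- apply/measurable_EFinP; meas.
  + exact: (measurableT_comp mh).
  + exact: (measurableT_comp mp).
  + apply: (measurableT_comp mg); meas.
- by move=> z; rewrite lee_fin !mulr_ge0 ?expR_ge0.
pose q (x : mR) := p x * expR (- ln x).
have q0 x : 0 <= q x by rewrite mulr_ge0 ?expR_ge0.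
have mq : measurable_fun [set: mR] q by rewrite /q; meas.
transitivity (\int[mu]_x \int[mu]_u
    (q x * h (u - ln x) * (expR u * g (expR u)))%:E)%E.
  apply: eq_integral => x _.
  rewrite -(@ge0_integral_translate (ln x) (fun u =>
     (q x * h (u - ln x) * (expR u * g (expR u)))%:E)); last 2 first.
  - by apply/measurable_EFinP; meas; apply: (measurableT_comp mh); meas.
  - by move=> u; rewrite lee_fin !mulr_ge0 ?expR_ge0.
  apply: eq_integral => v _; congr EFin; rewrite addrK /q /p.
  case: ltP => x0; last by rewrite !mul0r mulr0.
  rewrite !expRD expRN lnK ?posrE//; field; exact: lt0r_neq0.
rewrite (@fubini_tonelli _ _ _ _ _ mu mu
  (fun z : mR * mR => (q z.1 * h (z.2 - ln z.1) *
     (expR z.2 * g (expR z.2)))%:E))/=; last 2 first.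
- apply/measurable_EFinP; meas.
  + by apply: (measurableT_comp mp); meas.
  + by apply: (measurableT_comp mh); meas.
  + by apply: (measurableT_comp mg); meas.
- by move=> z; rewrite lee_fin !mulr_ge0 ?expR_ge0.
apply: eq_integral => u _.
(* The weight is [1 / x] on [[e^{u-1}, e^u[] and 0 elsewhere, so its integral is 1 whatever [u]: the
   constant of proportionality. *)
have hE x : q x * h (u - ln x) =
    ((fun x => x^-1) \_ (`[expR (u - 1), expR u[ : set mR)) x.
  rewrite /q /p patchE mem_setE in_itv/= /h indicE mem_setE in_itv/=.
  case: (ltP 0 x) => x0; last first.
    by rewrite !mul0r leNgt (le_lt_trans x0 (expR_gt0 _)).
  rewrite mul1r subr_gt0 lerBlDr addrC -lerBlDr.
  rewrite -ltr_expR -ler_expR expRN lnK ?posrE//.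
  by rewrite andbC; case: ifP => _; rewrite ?mulr1 ?mulr0.
under eq_integral do rewrite EFinM.
rewrite ge0_integralZr//; last 3 first.
- by apply/measurable_EFinP; meas; apply: (measurableT_comp mh); meas.
- by move=> x _; rewrite lee_fin mulr_ge0.
- by rewrite lee_fin mulr_ge0 ?expR_ge0.
have -> : (\int[mu]_x (q x * h (u - ln x))%:E =
    \int[mu]_(x in `[expR (u - 1), expR u[) (x^-1)%:E)%E.
  rewrite [RHS]integral_mkcond; apply: eq_integral => x _.
  by rewrite hE !patchE; case: ifP.
rewrite integral_itv_bndo_bndc; last first.
  apply/measurable_EFinP; apply: (eq_measurable_fun (fun x => expR (- ln x))).
    move=> x; rewrite inE/= in_itv/= => /andP[+ _].
    by move=> /(lt_le_trans (expR_gt0 _)) x0; rewrite expRN lnK.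
  by apply: measurable_funTS; meas.
rewrite integral_inv ?expR_gt0// ?ltr_expR ?ltrBlDr ?ltrDl//.
by rewrite !expRK opprB addrC subrK mul1e.
Qed.

End Substitution.

(** * Laplace integrals on the half-line *)

Section SignedSubstitution.
Variable R : realType.
Local Notation mR := (measurableTypeR R).
Local Notation mu := (@lebesgue_measure R).

(** The factor [expR v] is positive, so it commutes with positive and negative parts, and each part
    falls under the nonnegative case. *)
Lemma Rintegral_expR (g : R -> R) : measurable_fun [set: mR] g ->
  \int[mu]_(x in `]0%R, +oo[) g x = \int[mu]_v (expR v * g (expR v)).
Proof.
move=> mg; congr fine; rewrite integralE [RHS]integralE; congr (_ - _)%E.
- rewrite (eq_integral (fun x : mR => (Num.max (g x) 0)%:E)); last first.
    by move=> x _; rewrite funeposE EFin_max.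
  rewrite ge0_integral_expR; last 2 first.
  + by apply: measurable_maxr => //; exact: measurable_cst.
  + by move=> x; rewrite le_max lexx orbT.
  apply: eq_integral => v _; rewrite funeposE -EFin_max.
  by rewrite maxr_pMr ?expR_ge0// mulr0.
- rewrite (eq_integral (fun x : mR => (Num.max (- g x) 0)%:E)); last first.
    by move=> x _; rewrite funenegE EFin_max.
  rewrite ge0_integral_expR; last 2 first.
  + apply: measurable_maxr; last exact: measurable_cst.
    exact: measurable_funN.
  + by move=> x; rewrite le_max lexx orbT.
  apply: eq_integral => v _; rewrite funenegE -EFinN -EFin_max.
  by rewrite maxr_pMr ?expR_ge0// mulr0 mulrN.
Qed.

Lemma integral_reflect b (g : R -> \bar R) : measurable_fun [set: mR] g ->
  (\int[mu]_x g (b - x)%R = \int[mu]_x g x)%E.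
Proof.
move=> mg; rewrite integralE [RHS]integralE.
rewrite -(ge0_integral_reflect b (g := g^\+%E))//; last exact: measurable_funepos.
rewrite -(ge0_integral_reflect b (g := g^\-%E))//; last exact: measurable_funeneg.
by congr (_ - _)%E; apply: eq_integral => x _; rewrite ?funeposE ?funenegE.
Qed.

Lemma Rintegral_odd (g : R -> R) : measurable_fun [set: mR] g ->
  integ g -> (forall x, g (- x) = - g x) -> \int[mu]_x g x = 0.
Proof.
move=> mg ig oddg; apply/eqP; rewrite -[_ == 0](mulrn_eq0 _ 2) mulr2n.
rewrite addr_eq0 -mulN1r -RintegralZl//; apply/eqP.
rewrite -[LHS]/(fine (\int[mu]_x (EFin \o g) x)%E).
rewrite -(@integral_reflect 0)//; last exact/measurable_EFinP.
by apply: eq_Rintegral => x _; rewrite sub0r oddg mulN1r.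
Qed.

End SignedSubstitution.

Section HalfLine.
Variable R : realType.
Local Notation mR := (measurableTypeR R).
Local Notation mu := (@lebesgue_measure R).
Implicit Types (f F : R -> R).

Lemma cvg_exp_decay F (C s l : R) : 0 < s ->
  (forall x, 0 <= x -> `|F x - l| <= C * expR (- (s * x))) ->
  F x @[x --> +oo] --> l.
Proof.
move=> s0 FC; apply/cvgrPdist_le => e e0.
have c : C * expR (- (s * x)) @[x --> +oo] --> C * 0.
  apply: cvgMr; apply: (cvg_comp _ _ _ (@cvgr_expR R)).
  by apply: gt0_cvgMry => //; exact: cvg_id.
rewrite mulr0 in c; move/cvgrPdist_le : c => /(_ _ e0).
move=> [M [Mr HM]]; exists (Num.max M 0); split; first by rewrite num_real.
move=> x; rewrite gt_max => /andP[Mx x0]; rewrite distrC.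
apply: (le_trans (FC _ (ltW x0))); apply: le_trans (HM _ Mx).
by rewrite sub0r normrN ler_norm.
Qed.

Lemma integral_half_FTC f F (C s l : R) : 0 < s ->
  (forall x, 0 <= x -> 0 <= f x) -> continuous f ->
  (forall x : R, is_derive x 1 F (f x)) ->
  (forall x, 0 <= x -> `|F x - l| <= C * expR (- (s * x))) ->
  (\int[mu]_(x in `[0%R, +oo[) (f x)%:E = (l - F 0)%:E)%E.
Proof.
move=> s0 f0 cf dF FC; rewrite (@ge0_continuous_FTC2y _ f F 0 l)//.
- exact: continuous_subspaceT.
- exact: cvg_exp_decay FC.
- apply: cvg_at_right_filter; apply: differentiable_continuous.
  by apply/derivable1_diffP; apply: ex_derive.
- by move=> x _; rewrite derive1E; apply: derive_val.
Qed.

Lemma integral_gt0_FTC f F (C s l : R) : 0 < s ->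
  (forall x, 0 <= x -> 0 <= f x) -> continuous f ->
  (forall x : R, is_derive x 1 F (f x)) ->
  (forall x, 0 <= x -> `|F x - l| <= C * expR (- (s * x))) ->
  (\int[mu]_x ((0 < x)%R%:R * f x)%:E = (l - F 0)%:E)%E.
Proof.
move=> s0 f0 cf dF FC; rewrite -integral_gt0 integral_itv_obnd_cbnd.
  exact: (integral_half_FTC s0 f0 cf dF FC).
by apply/measurable_EFinP; apply: measurable_funTS; exact: continuous_measurable_fun.
Qed.

Lemma integral_even_FTC (g : R -> R) f F (C s l : R) : 0 < s ->
  continuous g -> (forall x, 0 <= g x) -> (forall x, g (- x) = g x) ->
  (forall x, 0 <= x -> g x = f x) -> continuous f ->
  (forall x : R, is_derive x 1 F (f x)) ->
  (forall x, 0 <= x -> `|F x - l| <= C * expR (- (s * x))) ->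
  (\int[mu]_x (g x)%:E = (2 * (l - F 0))%:E)%E.
Proof.
move=> s0 cg g0 evg gf cf dF FC; rewrite ge0_symfun_integralT//; last first.
  by move=> x /=; rewrite evg.
rewrite -set_itvcy EFinM; congr (_ * _)%E.
rewrite (eq_integral (fun x : mR => (f x)%:E)); last first.
  by move=> x; rewrite inE/= in_itv/= andbT => /gf ->.
apply: (integral_half_FTC s0 _ cf dF FC).
by move=> x x0; rewrite -gf.
Qed.

Lemma is_derive_mull (a x : R) : is_derive x 1 ( *%R a : R -> R) a.
Proof. by have := is_deriveZ a (is_derive_id x 1); rewrite [a *: 1]mulr1. Qed.

Lemma is_derive_expRM (a x : R) :
  is_derive x 1 (fun x => expR (a * x)) (a * expR (a * x)).
Proof.
apply: (is_derive_eq (is_derive1_comp (is_derive_expR (a * x)) (is_derive_mull a x))).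
by rewrite mulrC.
Qed.

Lemma is_derive_cosM (a x : R) :
  is_derive x 1 (fun x => cos (a * x)) (- (a * sin (a * x))).
Proof.
apply: (is_derive_eq (is_derive1_comp (is_derive_cos (a * x)) (is_derive_mull a x))).
by rewrite mulrC mulrN.
Qed.

Lemma is_derive_sinM (a x : R) :
  is_derive x 1 (fun x => sin (a * x)) (a * cos (a * x)).
Proof.
apply: (is_derive_eq (is_derive1_comp (is_derive_sin (a * x)) (is_derive_mull a x))).
by rewrite mulrC.
Qed.

Lemma is_derive_mulf (f g : R -> R) (x a b : R) :
  is_derive x 1 f a -> is_derive x 1 g b ->
  is_derive x 1 (fun y => f y * g y) (f x * b + g x * a).
Proof. by move=> fa gb; exact: is_deriveM. Qed.

Lemma is_derive_addf (f g : R -> R) (x a b : R) :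
  is_derive x 1 f a -> is_derive x 1 g b ->
  is_derive x 1 (fun y => f y + g y) (a + b).
Proof. by move=> fa gb; exact: is_deriveD. Qed.

Lemma is_derive_subf (f g : R -> R) (x a b : R) :
  is_derive x 1 f a -> is_derive x 1 g b ->
  is_derive x 1 (fun y => f y - g y) (a - b).
Proof. by move=> fa gb; exact: is_deriveB. Qed.

Lemma is_derive_scalef (k : R) (f : R -> R) (x a : R) :
  is_derive x 1 f a -> is_derive x 1 (fun y => k * f y) (k * a).
Proof. by move=> fa; exact: is_deriveZ. Qed.

(** With [z = s + i t], this is the real part of the antiderivative [- e^{- z x} / z] of
    [e^{- z x}]; [is_derive_damped_sin] is the imaginary part. *)
Lemma is_derive_damped_cos (s t x : R) : 0 < s ->
  is_derive x 1 (fun x => expR (- s * x) *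
      ((s ^+ 2 + t ^+ 2)^-1 * (t * sin (t * x) - s * cos (t * x))))
    (expR (- s * x) * cos (t * x)).
Proof.
move=> s0; have st : s ^+ 2 + t ^+ 2 != 0.
  by rewrite gt_eqF// ltr_pwDl ?exprn_gt0// sqr_ge0.
have dc := is_derive_scalef s (is_derive_cosM t x).
have ds := is_derive_scalef t (is_derive_sinM t x).
have dq := is_derive_scalef ((s ^+ 2 + t ^+ 2)^-1) (is_derive_subf ds dc).
apply: (is_derive_eq (is_derive_mulf (is_derive_expRM (- s) x) dq)).
by field.
Qed.

Lemma is_derive_damped_sin (s t x : R) : 0 < s ->
  is_derive x 1 (fun x => expR (- s * x) *
      ((s ^+ 2 + t ^+ 2)^-1 * (s * sin (t * x) + t * cos (t * x))))
    (expR (- s * x) * - sin (t * x)).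
Proof.
move=> s0; have st : s ^+ 2 + t ^+ 2 != 0.
  by rewrite gt_eqF// ltr_pwDl ?exprn_gt0// sqr_ge0.
have dc := is_derive_scalef t (is_derive_cosM t x).
have ds := is_derive_scalef s (is_derive_sinM t x).
have dq := is_derive_scalef ((s ^+ 2 + t ^+ 2)^-1) (is_derive_addf ds dc).
apply: (is_derive_eq (is_derive_mulf (is_derive_expRM (- s) x) dq)).
by field.
Qed.

Lemma trig_combo_bound (a b c x : R) : 0 < c ->
  `|c^-1 * (a * sin x + b * cos x)| <= c^-1 * (`|a| + `|b|).
Proof.
move=> c0; rewrite normrM (ger0_norm (x := c^-1)) ?invr_ge0 ?(ltW c0)//.
rewrite ler_pM2l ?invr_gt0// (le_trans (ler_normD _ _))//.
by rewrite lerD// normrM ler_piMr// ?sin_max ?cos_max.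
Qed.

Section DampedIntegral.
Variables (s B : R) (p q : R -> R).
Hypothesis s0 : 0 < s.
Hypothesis cp : continuous p.
Hypothesis p1 : forall x, `|p x| <= 1.
Hypothesis qB : forall x, `|q x| <= B.
Hypothesis dq : forall x : R,
  is_derive x 1 (fun x => expR (- s * x) * q x) (expR (- s * x) * p x).

Lemma continuous_expRM (a : R) : continuous (fun x : R => expR (a * x)).
Proof.
move=> x; apply: (@continuous_comp _ _ _ ( *%R a) (@expR R)).
  exact: mulrl_continuous.
exact: continuous_expR.
Qed.

(* 1 + p is nonnegative, as the improper fundamental theorem of calculus requires. *)
Let f1 (x : R) := expR (- s * x) * (1 + p x).
Let F1 (x : R) := expR (- s * x) * (q x - s^-1).

Lemma damped_ge0 x : 0 <= f1 x.
Proof.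
rewrite mulr_ge0 ?expR_ge0//; have := p1 x; rewrite ler_norml => /andP[+ _].
by rewrite -subr_ge0 opprK addrC.
Qed.

Lemma damped_continuous : continuous f1.
Proof.
move=> x; apply: cvgM; first exact: continuous_expRM.
by apply: cvgD; [exact: cvg_cst|exact: cp].
Qed.

Lemma damped_derive (x : R) : is_derive x 1 F1 (f1 x).
Proof.
rewrite (_ : F1 = fun y => expR (- s * y) * q y - s^-1 * expR (- s * y)).
  apply: (is_derive_eq (is_derive_subf (dq x)
    (is_derive_scalef s^-1 (is_derive_expRM (- s) x)))).
  by rewrite /f1; field; exact: lt0r_neq0.
by apply/funext => y; rewrite /F1; ring.
Qed.

Lemma damped_decay x : `|F1 x - 0| <= (B + s^-1) * expR (- (s * x)).
Proof.
rewrite subr0 normrM ger0_norm ?expR_ge0// mulrC mulNr ler_wpM2r ?expR_ge0//.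
rewrite (le_trans (ler_normB _ _))// lerD//.
by rewrite ger0_norm// invr_ge0 ltW.
Qed.

Lemma damped_integral :
  (\int[mu]_x ((0 < x)%R%:R * f1 x)%:E = (s^-1 - q 0)%:E)%E.
Proof.
rewrite (integral_gt0_FTC (C := B + s^-1)
  (l := 0) s0 _ damped_continuous damped_derive).
- by rewrite /F1 mulr0 expR0 mul1r sub0r opprB.
- by move=> x _; exact: damped_ge0.
- by move=> x _; exact: damped_decay.
Qed.

End DampedIntegral.

Lemma integral_gt0_exp (s : R) : 0 < s ->
  (\int[mu]_x ((0 < x)%R%:R * expR (- s * x))%:E = (s^-1)%:E)%E.
Proof.
move=> s0; have dF (x : R) :
    is_derive x 1 (fun x => - s^-1 * expR (- s * x)) (expR (- s * x)).
  apply: (is_derive_eq (is_derive_scalef (- s^-1) (is_derive_expRM (- s) x))).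
  by field; exact: lt0r_neq0.
rewrite (integral_gt0_FTC (C := s^-1) (l := 0) s0 _ (@continuous_expRM (- s)) dF).
- by rewrite mulr0 expR0 mulr1 sub0r opprK.
- by move=> x _; exact: expR_ge0.
- move=> x _; rewrite subr0 normrM normrN (ger0_norm (expR_ge0 _)) mulNr.
  by rewrite ger0_norm// invr_ge0 ltW.
Qed.

Lemma measurable_gt0_exp (s : R) :
  measurable_fun [set: mR] (fun x : mR => (0 < x)%R%:R * expR (- s * x)).
Proof. by meas; exact: measurable_gt0. Qed.

Lemma integ_gt0_exp (s : R) : 0 < s ->
  integ (fun x => (0 < x)%R%:R * expR (- s * x)).
Proof.
move=> s0; apply/integP; first exact: measurable_gt0_exp.
  by move=> x; rewrite mulr_ge0 ?expR_ge0.
by rewrite integral_gt0_exp// ltry.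
Qed.

(** Subtracting the integral [1 / s] of the damped constant 1 from [damped_integral] leaves the
    value for the signed [p]. *)
Lemma Rintegral_damped (s B : R) (p q : R -> R) : 0 < s -> continuous p ->
  (forall x, `|p x| <= 1) -> (forall x, `|q x| <= B) ->
  (forall x : R, is_derive x 1 (fun x => expR (- s * x) * q x)
     (expR (- s * x) * p x)) ->
  \int[mu]_x ((0 < x)%R%:R * (expR (- s * x) * p x)) = - q 0.
Proof.
move=> s0 cp p1 qB dq; have mp : measurable_fun [set: mR] p.
  exact: continuous_measurable_fun.
have i0 := integ_gt0_exp s0.
have i1 : integ (fun x => (0 < x)%R%:R * (expR (- s * x) * p x)).
  apply: (integ_le _ i0); first by meas; exact: measurable_gt0.
  move=> x; rewrite mulrA normrM ger0_norm ?mulr_ge0 ?expR_ge0//.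
  by rewrite ler_piMr// mulr_ge0 ?expR_ge0.
have := damped_integral s0 cp p1 qB dq.
under eq_integral do rewrite mulrDr mulr1 mulrDr.
move=> /(congr1 fine); rewrite -[LHS]/(\int[mu]_x _) RintegralD//=.
rewrite [X in X + _](_ : _ = s^-1); last first.
  by rewrite /Rintegral integral_gt0_exp.
by move=> /addrI.
Qed.

(** Serves twice: as the factor [1 / z] in the functional equation of Gamma, and as the factor
    [1 / s] that turns a density into a distribution function. *)
Lemma Cint_laplace (s t : R) : 0 < s ->
  Cint (fun x => ((0 < x)%R%:R)%:C%C * cexp (- (s +i* t)%C * x%:C%C)) =
  ((s +i* t)%C)^-1.
Proof.
move=> s0; have st0 : 0 < s ^+ 2 + t ^+ 2.
  by rewrite ltr_pwDl ?exprn_gt0// sqr_ge0.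
rewrite (@eq_Cint _ _ (fun x =>
    ((0 < x)%R%:R * (expR (- s * x) * cos (t * x)) +i*
     ((0 < x)%R%:R * (expR (- s * x) * - sin (t * x))))%C)); last first.
  move=> x; rewrite cexpE; apply: complexP; rewrite /= !mulr0 !mul0r ?subr0 ?addr0.
    by rewrite add0r [- t * x]mulNr cosN.
  by rewrite add0r [- t * x]mulNr sinN.
have cc : continuous (fun x : R => cos (t * x)).
  move=> x; apply: (@continuous_comp _ _ _ ( *%R t) (@cos R)).
    exact: mulrl_continuous.
  exact: continuous_cos.
have cs : continuous (fun x : R => - sin (t * x)).
  move=> x; apply: cvgN; apply: (@continuous_comp _ _ _ ( *%R t) (@sin R)).
    exact: mulrl_continuous.
  exact: continuous_sin.
apply: complexP; rewrite [LHS]/=.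
- rewrite (Rintegral_damped (B := (s ^+ 2 + t ^+ 2)^-1 * (`|t| + `|- s|)) s0 cc
    _ _ (fun x => is_derive_damped_cos t x s0)).
  + by rewrite mulr0 sin0 cos0 mulr0 sub0r mulr1 mulrN opprK mulrC.
  + by move=> x; exact: cos_max.
  + by move=> x; rewrite -mulNr; exact: trig_combo_bound.
- rewrite (Rintegral_damped (B := (s ^+ 2 + t ^+ 2)^-1 * (`|s| + `|t|)) s0 cs
    _ _ (fun x => is_derive_damped_sin t x s0)).
  + by rewrite mulr0 sin0 cos0 mulr0 add0r mulr1 mulrC.
  + by move=> x; rewrite normrN; exact: sin_max.
  + by move=> x; exact: trig_combo_bound.
Qed.

End HalfLine.

(** * The Poisson kernel *)

Section PoissonKernel.
Variable R : realType.
Local Notation mR := (measurableTypeR R).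
Local Notation mu := (@lebesgue_measure R).

Lemma continuous_exp_abs (s : R) : continuous (fun x : R => expR (- s * `|x|)).
Proof.
move=> x; apply: (@continuous_comp _ _ _ (fun x : R => `|x|) (fun y => expR (- s * y))).
  exact: norm_continuous.
exact: continuous_expRM.
Qed.

Lemma integral_exp_abs (s : R) : 0 < s ->
  (\int[mu]_x (expR (- s * `|x|))%:E = (2 / s)%:E)%E.
Proof.
move=> s0; have dF (x : R) :
    is_derive x 1 (fun x => - s^-1 * expR (- s * x)) (expR (- s * x)).
  apply: (is_derive_eq (is_derive_scalef (- s^-1) (is_derive_expRM (- s) x))).
  by field; exact: lt0r_neq0.
rewrite (integral_even_FTC (f := fun x => expR (- s * x)) (C := s^-1) (l := 0) s0
  (@continuous_exp_abs s) _ _ _ (@continuous_expRM _ (- s)) dF).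
- by rewrite mulr0 expR0 mulr1 sub0r opprK.
- by move=> x; exact: expR_ge0.
- by move=> x; rewrite normrN.
- by move=> x x0; rewrite ger0_norm.
- move=> x _; rewrite subr0 normrM normrN (ger0_norm (expR_ge0 _)) mulNr.
  by rewrite ger0_norm// invr_ge0 ltW.
Qed.

Lemma integ_exp_abs (s : R) : 0 < s -> integ (fun x => expR (- s * `|x|)).
Proof.
move=> s0; apply/integP.
- by apply: continuous_measurable_fun; exact: continuous_exp_abs.
- by move=> x; exact: expR_ge0.
- by rewrite integral_exp_abs// ltry.
Qed.

Lemma measurable_cosM (y : R) : measurable_fun [set: mR] (fun t : mR => cos (y * t)).
Proof.
apply: (measurableT_comp (f := @cos R)); last by meas.
by apply: continuous_measurable_fun; exact: continuous_cos.
Qed.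

Lemma measurable_sinM (y : R) : measurable_fun [set: mR] (fun t : mR => sin (y * t)).
Proof.
apply: (measurableT_comp (f := @sin R)); last by meas.
by apply: continuous_measurable_fun; exact: continuous_sin.
Qed.

Lemma integ_exp_abs_le (s : R) (p : R -> R) : 0 < s ->
  measurable_fun [set: mR] p -> (forall x, `|p x| <= 1) ->
  integ (fun x => expR (- s * `|x|) * p x).
Proof.
move=> s0 mp p1; apply: (integ_le _ (integ_exp_abs s0)).
  by meas.
by move=> x; rewrite normrM ger0_norm ?expR_ge0// ler_piMr ?expR_ge0.
Qed.

(** The computation is made for [1 + cos (y * t)], which is nonnegative and even; the constant 1
    contributes [2 / s] and is then removed. *)
Lemma Rintegral_poisson (s y : R) : 0 < s ->
  \int[mu]_t (expR (- s * `|t|) * cos (y * t)) = 2 * s / (s ^+ 2 + y ^+ 2).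
Proof.
move=> s0; have sy0 : 0 < s ^+ 2 + y ^+ 2.
  by rewrite ltr_pwDl ?exprn_gt0// sqr_ge0.
have cc : continuous (fun x : R => cos (y * x)).
  move=> x; apply: (@continuous_comp _ _ _ ( *%R y) (@cos R)).
    exact: mulrl_continuous.
  exact: continuous_cos.
have p1 x : `|cos (y * x)| <= 1 by exact: cos_max.
have dq x := is_derive_damped_cos y x s0.
have qB x : `|(s ^+ 2 + y ^+ 2)^-1 * (y * sin (y * x) - s * cos (y * x))| <=
    (s ^+ 2 + y ^+ 2)^-1 * (`|y| + `|- s|).
  by rewrite -mulNr; exact: trig_combo_bound.
have : (\int[mu]_t (expR (- s * `|t|) * (1 + cos (y * t)))%:E =
    (2 * (s^-1 + s / (s ^+ 2 + y ^+ 2)))%:E)%E.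
  rewrite (integral_even_FTC (l := 0) s0 _ _ _ _ (damped_continuous cc)
    (damped_derive s0 dq) (fun x _ => damped_decay s0 qB x)).
  - rewrite !mulr0 expR0 sin0 cos0 mulr0 sub0r mulr1 mul1r; congr (2 * _)%:E.
    by rewrite sub0r; field; rewrite !gt_eqF.
  - move=> x; apply: cvgM; first exact: continuous_exp_abs.
    by apply: cvgD; [exact: cvg_cst|exact: cc].
  - by move=> x; rewrite mulr_ge0 ?expR_ge0.
  - by move=> x; rewrite normrN mulrN cosN.
  - by move=> x x0; rewrite ger0_norm.
under eq_integral do rewrite mulrDr mulr1.
move=> /(congr1 fine); rewrite -[LHS]/(\int[mu]_x _) RintegralD//=; last 2 first.
- exact: integ_exp_abs.
- by apply: integ_exp_abs_le => //; exact: measurable_cosM.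
rewrite [X in X + _](_ : _ = 2 / s); last first.
  by rewrite /Rintegral integral_exp_abs.
by rewrite mulrDr => /addrI ->; rewrite mulrA.
Qed.

(** The imaginary part vanishes by oddness. As [s] tends to 0 the right-hand side concentrates at
    [y = 0] with total mass [2 pi], which is the constant in [inversion_at]. *)
Lemma Cint_poisson (s y : R) : 0 < s ->
  Cint (fun t => (expR (- s * `|t|))%:C%C * cexp (0 +i* (t * y))%C) =
  (2 * s / (s ^+ 2 + y ^+ 2))%:C%C.
Proof.
move=> s0; rewrite (@eq_Cint _ _ (fun t =>
    (expR (- s * `|t|) * cos (y * t)) +i* (expR (- s * `|t|) * sin (y * t)))%C).
  apply: complexP; rewrite [LHS]/=; first exact: Rintegral_poisson.
  rewrite Rintegral_odd//.
  - by meas; exact: measurable_sinM.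
  - apply: integ_exp_abs_le => //; first exact: measurable_sinM.
    by move=> x; exact: sin_max.
  - by move=> t; rewrite normrN mulrN sinN mulrN.
move=> t; rewrite cexpE; apply: complexP; rewrite /= mul0r ?subr0 ?addr0 expR0 mul1r;
  by rewrite [t * y]mulrC.
Qed.

End PoissonKernel.

(** * Log-Gamma densities and Euler's integral over the whole line *)

Section GammaLog.
Variable R : realType.
Local Notation mR := (measurableTypeR R).
Local Notation mu := (@lebesgue_measure R).

(* The substitution x = e^v turns x^a e^{-x} into this function, and dx/x into dv. *)
Definition loggamma (a v : R) : R := expR (a * v - expR v).

Lemma loggamma_ge0 a v : 0 <= loggamma a v. Proof. exact: expR_ge0. Qed.

Lemma measurable_loggamma a : measurable_fun [set: mR] (loggamma a : mR -> R).
Proof. by rewrite /loggamma; meas. Qed.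

Lemma continuous_loggamma (b : R) : continuous (loggamma b).
Proof.
move=> x; apply: (@continuous_comp _ _ _ (fun v => b * v - expR v) (@expR R));
  last exact: continuous_expR.
by apply: cvgB; [exact: mulrl_continuous|exact: continuous_expR].
Qed.

Lemma loggammaD a b v : expR (a * v) * loggamma b v = loggamma (a + b) v.
Proof. by rewrite /loggamma -expRD mulrDl addrA. Qed.

(** For [v >= 0], [e^v >= 1 + v^2 / 2] absorbs [(a + 1) v] up to [(a + 1)^2 / 2] and leaves a decay
    [e^{-v}]; for [v < 0] the factor [e^{a v}] already decays. The minimum of the two rates serves
    both sides. *)
Lemma loggamma_bound a v : 0 < a ->
  loggamma a v <= expR ((a + 1) ^+ 2 / 2) * expR (- Num.min a 1 * `|v|).
Proof.
move=> a0; rewrite /loggamma -expRD ler_expR.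
have m1 : Num.min a 1 <= 1 by rewrite ge_min lexx orbT.
have ma : Num.min a 1 <= a by rewrite ge_min lexx.
have [v0|v0] := leP 0 v.
- rewrite ger0_norm//; have := @expR_ge1Dxn R v 1 v0; rewrite (_ : 2`! = 2%N)// => hv.
  have h1 : Num.min a 1 * v <= 1 * v by rewrite ler_wpM2r.
  have := sqr_ge0 (a + 1 - v); nra.
- rewrite ltr0_norm//; have := expR_ge0 v.
  have h1 : Num.min a 1 * (- v) <= a * (- v) by rewrite ler_wpM2r// oppr_ge0 ltW.
  have := sqr_ge0 (a + 1); nra.
Qed.

Lemma loggamma_le a v : 0 < a -> loggamma a v <= expR ((a + 1) ^+ 2 / 2).
Proof.
move=> a0; apply: (le_trans (loggamma_bound v a0)).
rewrite ler_piMr ?expR_ge0// expR_le1 mulNr oppr_le0 mulr_ge0//.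
by rewrite le_min ltW//=.
Qed.

Lemma integ_loggamma a : 0 < a -> integ (loggamma a).
Proof.
move=> a0; have m0 : 0 < Num.min a 1 by rewrite lt_min a0 ltr01.
apply: (integ_le (measurable_loggamma a)
  (integZ (expR ((a + 1) ^+ 2 / 2)) (integ_exp_abs m0))).
by move=> v; rewrite ger0_norm ?loggamma_ge0//; exact: loggamma_bound.
Qed.

Lemma Rintegral_loggamma_gt0 a : 0 < a -> 0 < \int[mu]_v loggamma a v.
Proof.
move=> a0; rewrite lt_neqAle Rintegral_ge0 ?andbT; last first.
  by move=> v _; exact: loggamma_ge0.
apply/negP => /eqP/esym I0.
have : (\int[mu]_v (loggamma a v)%:E = 0)%E.
  apply/eqP; rewrite -fine_eq0; first exact/eqP.
  exact: (integrable_fin_num _ (integ_loggamma a0)).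
have : (\int[mu]_(v in `[0%R, 1%R]) (loggamma a v)%:E <=
    \int[mu]_v (loggamma a v)%:E)%E.
  apply: ge0_subset_integral => //.
  - by apply/measurable_EFinP; exact: measurable_loggamma.
  - by move=> v _; rewrite lee_fin loggamma_ge0.
move=> /[swap] ->; apply/negP; rewrite -ltNge.
(* On [[0, 1]] the exponent [a v - e^v] is at least [- e], so this interval alone contributes at
   least [e^{-e}]. *)
apply: (@lt_le_trans _ _ (\int[mu]_(v in `[0%R, 1%R]) (expR (- expR 1))%:E)%E).
  rewrite integral_cst//= lebesgue_measure_itv/= lte_fin ltr01 sube0 mule1.
  by rewrite lte_fin expR_gt0.
apply: ge0_le_integral => //.
- by apply/measurable_EFinP; apply: measurable_funTS; exact: measurable_loggamma.
- move=> v /=; rewrite in_itv/= => /andP[v0 v1]; rewrite lee_fin ler_expR.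
  have ev : expR v <= expR 1 by rewrite ler_expR.
  by have := mulr_ge0 (ltW a0) v0; lra.
Qed.

(** Here [a - s] has positive real part, so [Gamma_shift] is 0, the denominator is an empty product,
    and Euler's integral remains; the substitution [x = e^v] does the rest. *)
Lemma Gamma_loggamma (a : R) (s : R[i]) : complex.Re s < a ->
  Gamma (a%:C%C - s) = Cint (fun v => (loggamma a v)%:C%C * cexp (- s * v%:C%C)).
Proof.
move=> sa; rewrite /Gamma /Gamma_shift ReD ReN ReC subr_gt0 sa big_ord0 divr1 addr0.
set z := a%:C%C - s.
have mf : cmeasurable (fun t : mR => cpow t (z - 1) * (expR (- t))%:C%C).
  apply: cmeasurableM; last by apply: cmeasurable_real; meas.
  apply: cmeasurable_cexp; apply: cmeasurableM; first exact: cmeasurable_cst.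
  by apply: cmeasurable_real; exact: measurable_ln.
have E v : (expR v)%:C%C * (cpow (expR v) (z - 1) * (expR (- expR v))%:C%C) =
    (loggamma a v)%:C%C * cexp (- s * v%:C%C).
  rewrite /cpow expRK /loggamma expRD realcM -!cexp_real -!cexpD; congr cexp.
  by rewrite /z realcM; ring.
rewrite /Gamma_integral /cintegral !Rintegral_expR; [|exact: mf.2|exact: mf.1].
rewrite /Cint /cintegral; congr (_ +i* _)%C; apply: eq_Rintegral => v _.
- by rewrite -E [RHS]ReM ImC mul0r subr0 ReC.
- by rewrite -E [RHS]ImM ImC mul0r addr0 ReC.
Qed.

Lemma Gamma_real (a : R) : 0 < a ->
  Gamma a%:C%C = (\int[mu]_v loggamma a v)%:C%C.
Proof.
move=> a0; rewrite -[a%:C%C]subr0 Gamma_loggamma// -Cint_real.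
by apply: eq_Cint => v; rewrite oppr0 mul0r cexp0 mulr1.
Qed.

End GammaLog.

(** * Mellin transforms and multiplicative convolutions in logarithmic variables *)

Section MellinPairs.
Variable R : realType.
Local Notation mR := (measurableTypeR R).
Local Notation mu := (@lebesgue_measure R).
Local Notation normc := (@ComplexField.Normc.normc R).
Implicit Types (F g w : R -> R) (psi ghat : R -> R[i]) (s : R).

(* For w = id, the Mellin transform at s + i t of x |-> g (ln x); in general, that
   of the image of g under w. *)
Definition ltransform g w s (t : R) : R[i] :=
  Cint (fun r => (g r)%:C%C * cexp (- (s +i* t)%C * (w r)%:C%C)).

(** Convolution of [F] with the image under [w] of the measure [g dr]. Keeping [w] apart lets a law
    carried by a half-line, such as the Beta law in [ln u], be integrated over a parameter on the
    whole line. *)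
Definition logconv g w F (v : R) : R := \int[mu]_r (g r * F (v - w r)).

Definition kernel_at s g w := [/\ forall r, 0 <= g r,
  measurable_fun [set: mR] g, measurable_fun [set: mR] w &
  integ (fun r => g r * expR (- s * w r))].

(** The bound [B] makes convolution integrals against [F] converge at every point, where
    integrability alone would give almost every point. *)
Definition density_at s F := [/\ forall v, 0 <= F v,
  measurable_fun [set: mR] F,
  (exists B, forall v, F v * expR (- s * v) <= B) &
  integ (fun v => F v * expR (- s * v))].

Lemma density_kernel s F : density_at s F -> kernel_at s F id.
Proof. by case=> F0 mF _ iF; split => //; exact: measurable_id. Qed.

Lemma measurable_logconv s g w F : kernel_at s g w -> density_at s F ->
  measurable_fun [set: mR] (logconv g w F : mR -> R).
Proof.
move=> [g0 mg mw _] [F0 mF _ _]; rewrite /logconv /Rintegral.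
apply: (measurableT_comp (f := @fine R)); first exact: fine_measurable.
apply: (measurable_fun_fubini_tonelli_F (fun z : mR * mR =>
  (g z.2 * F (z.1 - w z.2))%:E)).
  apply/measurable_EFinP; meas; first exact: (measurableT_comp mg).
  apply: (measurableT_comp mF); meas; exact: (measurableT_comp mw).
by move=> z; rewrite lee_fin mulr_ge0.
Qed.

Lemma logconv_ge0 g w F v : (forall r, 0 <= g r) -> (forall v, 0 <= F v) ->
  0 <= logconv g w F v.
Proof. by move=> g0 F0; apply: Rintegral_ge0 => r _; rewrite mulr_ge0. Qed.

Lemma normc_line_cexp s t (x : R) :
  normc (cexp (- (s +i* t)%C * x%:C%C)) = expR (- s * x).
Proof. by rewrite normc_cexp ReM/= mulr0 subr0. Qed.

Lemma normc_line_cexpV s t (x : R) :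
  normc (cexp ((s +i* t)%C * x%:C%C)) = expR (s * x).
Proof. by rewrite normc_cexp ReM/= mulr0 subr0. Qed.

Section Conv.
Variables (s : R) (g w F : R -> R).
Hypothesis kg : kernel_at s g w.
Hypothesis dF : density_at s F.

Let g' r := g r * expR (- s * w r).
Let F' v := F v * expR (- s * v).

Let g0 r : 0 <= g r. Proof. by case: kg. Qed.
Let F0 v : 0 <= F v. Proof. by case: dF. Qed.
Let mg : measurable_fun [set: mR] g. Proof. by case: kg. Qed.
Let mw : measurable_fun [set: mR] w. Proof. by case: kg. Qed.
Let mF : measurable_fun [set: mR] F. Proof. by case: dF. Qed.
Let ig' : integ g'. Proof. by case: kg. Qed.
Let iF' : integ F'. Proof. by case: dF. Qed.
Let g'0 r : 0 <= g' r. Proof. by rewrite mulr_ge0 ?expR_ge0. Qed.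
Let F'0 r : 0 <= F' r. Proof. by rewrite mulr_ge0 ?expR_ge0. Qed.
Let mg' : measurable_fun [set: mR] g'. Proof. exact: integ_measurable. Qed.
Let mF' : measurable_fun [set: mR] F'. Proof. exact: integ_measurable. Qed.

Let G (z : mR * mR) := g' z.2 * F' (z.1 - w z.2).

(** The tilt is multiplicative on [v = w r + (v - w r)]: the tilted convolution is the convolution
    of the tilted factors. *)
Let GE v r : G (v, r) = expR (- s * v) * (g r * F (v - w r)).
Proof.
rewrite /G /g' /F' /= [in RHS](_ : - s * v = - s * w r + - s * (v - w r)); last by ring.
by rewrite expRD; ring.
Qed.

Let mG : measurable_fun [set: mR * mR] G.
Proof.
rewrite /G; apply: measurable_funM; first exact: (measurableT_comp mg').
apply: (measurableT_comp mF'); meas; exact: (measurableT_comp mw).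
Qed.

Let G0 z : 0 <= G z. Proof. by rewrite mulr_ge0. Qed.

Let G1 v : integ (fun r => G (v, r)).
Proof.
have [_ _ [B HB] _] := dF; apply: (integ_le _ (integZ B ig')).
  exact: (measurableT_comp mG).
by move=> r; rewrite ger0_norm// /G/= mulrC ler_wpM2r//; exact: HB.
Qed.

Let G2 r : integ (fun v => G (v, r)).
Proof. exact: (integZ (g' r) (integ_translate (- w r) iF')). Qed.

Let Goo : (\int[mu]_v \int[mu]_r (G (v, r))%:E < +oo)%E.
Proof.
rewrite (@fubini_tonelli _ _ _ _ _ mu mu (EFin \o G))/=; last 2 first.
- exact/measurable_EFinP.
- by move=> z; rewrite lee_fin.
rewrite (eq_integral (fun r : mR => (g' r * \int[mu]_v F' v)%:E)); last first.
  move=> r _ /=; rewrite /G /=; under eq_integral do rewrite EFinM.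
  rewrite ge0_integralZl//; last 3 first.
  - apply/measurable_EFinP; apply: (measurableT_comp mF'); meas.
  - by move=> v _; rewrite lee_fin.
  - by rewrite lee_fin.
  rewrite [RHS]EFinM; congr (_ * _)%E.
  rewrite (@ge0_integral_translate R (- w r) (fun v => (F' v)%:E))//; last first.
    exact/measurable_EFinP.
  by rewrite fineK//; exact: (integrable_fin_num _ iF').
have := integZ (\int[mu]_v F' v) ig'.
move=> /integrableP[_]; apply: le_lt_trans; apply: ge0_le_integral => //=.
- by move=> r _; rewrite lee_fin mulr_ge0// Rintegral_ge0.
- by apply/measurable_EFinP; meas.
- by apply/measurable_EFinP; meas.
- by move=> r _; rewrite lee_fin mulrC ler_norm.
Qed.

Let i1 v : integ (fun r => g r * F (v - w r)).
Proof.
rewrite (_ : (fun r => _) = fun r => (expR (- s * v))^-1 * G (v, r)).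
  exact: (integZ _ (G1 v)).
by apply/funext => r; rewrite GE mulKf// gt_eqF ?expR_gt0.
Qed.

Let convE v : logconv g w F v * expR (- s * v) = \int[mu]_r G (v, r).
Proof.
under [RHS]eq_Rintegral do rewrite GE.
by rewrite (RintegralZl _ measurableT (i1 v)); exact: mulrC.
Qed.

Lemma integ_logconv_integrand v : integ (fun r => g r * F (v - w r)).
Proof. exact: i1. Qed.

Lemma density_logconv : density_at s (logconv g w F).
Proof.
split.
- by move=> v; exact: logconv_ge0.
- exact: measurable_logconv kg dF.
- have [_ _ [B HB] _] := dF; exists (B * \int[mu]_r g' r) => v.
  rewrite convE -RintegralZl//; apply: le_Rintegral => //.
  + exact: G1.
  + exact: integZ.
  + by move=> r _; rewrite /G/= mulrC ler_wpM2r//; exact: HB.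
- under [X in integ X]funext do rewrite convE.
  by apply: (integ_fubini mG G1 Goo mG) => z; rewrite ger0_norm.
Qed.

Lemma ltransform_logconv t :
  ltransform (logconv g w F) id s t = ltransform F id s t * ltransform g w s t.
Proof.
pose f (z : mR * mR) := (g z.2 * F (z.1 - w z.2))%:C%C *
  cexp (- (s +i* t)%C * z.1%:C%C).
have mf : cmeasurable f.
  apply: cmeasurableM.
    apply: cmeasurable_real; meas; first exact: (measurableT_comp mg).
    apply: (measurableT_comp mF); meas; exact: (measurableT_comp mw).
  apply: cmeasurable_cexp; apply: cmeasurableM; first exact: cmeasurable_cst.
  by apply: cmeasurable_real; meas.
have fG z : normc (f z) <= G z.
  case: z => v r; rewrite GE /f ComplexField.Normc.normcM normc_line_cexp.
  by rewrite normc_real ?mulr_ge0// mulrC.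
have mexp (p : R -> R) : measurable_fun [set: mR] p ->
    cmeasurable (fun v : mR => (p v)%:C%C * cexp (- (s +i* t)%C * v%:C%C)).
  move=> mp; apply: cmeasurableM; first exact: cmeasurable_real.
  apply: cmeasurable_cexp; apply: cmeasurableM; first exact: cmeasurable_cst.
  by apply: cmeasurable_real; meas.
transitivity (Cint (fun v => Cint (fun r => f (v, r)))).
  apply: eq_Cint => v; rewrite /f /=.
  under [RHS]eq_Cint do rewrite mulrC.
  rewrite CintZ; last first.
    apply: (cinteg_le _ (i1 v)); first by apply: cmeasurable_real;
      exact: (integ_measurable (i1 v)).
    by move=> r; rewrite normc_real ?mulr_ge0.
  by rewrite Cint_real mulrC.
rewrite (Cint_fubini mG G1 G2 Goo mf fG).
transitivity (Cint (fun r => ltransform F id s t *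
    ((g r)%:C%C * cexp (- (s +i* t)%C * (w r)%:C%C)))).
  (* With [r] fixed, translating [v] by [w r] splits the exponential into a factor in [r] and the
     transform of [F]. *)
  apply: eq_Cint => r; rewrite /ltransform.
  rewrite -(Cint_translate (- w r) (mexp _ mF)) mulrC -CintZ; last first.
    apply: (cinteg_le _ (integ_translate (- w r) iF')).
      apply: (cmeasurable_comp (mexp _ mF)); meas.
    by move=> v; rewrite ComplexField.Normc.normcM normc_line_cexp normc_real.
  apply: eq_Cint => v; rewrite /f /= realcM.
  rewrite [in LHS](_ : v = w r + (v - w r)); last by ring.
  have -> : w r + (v - w r) - w r = v - w r by ring.
  by rewrite realcD mulrDr cexpD; ring.
rewrite CintZ//; apply: (cinteg_le _ ig').
  apply: cmeasurableM; first exact: cmeasurable_real.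
  apply: cmeasurable_cexp; apply: cmeasurableM; first exact: cmeasurable_cst.
  exact: cmeasurable_real.
by move=> r; rewrite ComplexField.Normc.normcM normc_line_cexp normc_real.
Qed.

(** Only the absolutely convergent inverse integral along the line is recorded. The constant is
    [2 pi] and not [2 pi i] because [ds = i dt] on the line. *)
Definition inversion_at psi (H : R -> R) := cinteg psi /\
  forall v, Cint (fun t => psi t * cexp ((s +i* t)%C * v%:C%C)) = (2 * pi * H v)%:C%C.

(** One absolutely integrable factor is enough: up to a constant, the integrand in [(t, r)] is
    dominated by [|psi t| * g' r], a product of integrable functions. After the swap, the inner
    integral in [t] is the known inversion at the point [v - w r]. *)
Lemma inversion_logconv psi : inversion_at psi F ->
  inversion_at (fun t => psi t * ltransform g w s t) (logconv g w F).
Proof.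
move=> [ipsi inv]; have ipsi' := integ_normc ipsi.
pose H v (z : mR * mR) := expR (s * v) * normc (psi z.1) * g' z.2.
pose f v (z : mR * mR) := psi z.1 * cexp ((s +i* z.1)%C * v%:C%C) *
  ((g z.2)%:C%C * cexp (- (s +i* z.1)%C * (w z.2)%:C%C)).
have mline k (h : mR * mR -> R) : measurable_fun setT h ->
    cmeasurable (fun z : mR * mR => cexp ((k * (s +i* z.1)%C) * (h z)%:C%C)).
  move=> mh; apply: cmeasurable_cexp; apply: cmeasurableM.
    apply: cmeasurableM; first exact: cmeasurable_cst.
    by apply: cmeasurable_complex; meas.
  exact: cmeasurable_real.
have mf v : cmeasurable (f v).
  apply: cmeasurableM; apply: cmeasurableM.
  - exact: (cmeasurable_comp (cinteg_measurable ipsi)).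
  - under eq_fun do rewrite -[(s +i* _)%C]mul1r.
    by apply: mline; meas.
  - by apply: cmeasurable_real; exact: (measurableT_comp mg).
  - under eq_fun do rewrite -mulN1r.
    by apply: mline; exact: (measurableT_comp mw).
have H0 v z : 0 <= H v z by rewrite !mulr_ge0 ?expR_ge0 ?normc_ge0.
have mH v : measurable_fun [set: mR * mR] (H v).
  rewrite /H; apply: measurable_funM; last exact: (measurableT_comp mg').
  apply: measurable_funM; first by meas.
  exact: (measurableT_comp (integ_measurable ipsi')).
have H1 v t : integ (fun r => H v (t, r)) by exact: (integZ (expR (s * v) * normc
  (psi t)) ig').
have H2 v r : integ (fun t => H v (t, r)).
  rewrite (_ : (fun t => _) = fun t => (expR (s * v) * g' r) * normc (psi t)).
    exact: (integZ (expR (s * v) * g' r) ipsi').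
  by apply/funext => t; rewrite /H/=; ring.
have Hoo v : (\int[mu]_t \int[mu]_r (H v (t, r))%:E < +oo)%E.
  apply: (integral_tensor_lty (integZ (expR (s * v)) ipsi') ig') => // t.
  by rewrite mulr_ge0 ?expR_ge0 ?normc_ge0.
have fH v z : normc (f v z) <= H v z.
  rewrite /f ComplexField.Normc.normcM (ComplexField.Normc.normcM (psi _)).
  rewrite (ComplexField.Normc.normcM (g z.2)%:C%C) normc_line_cexpV normc_line_cexp.
  by rewrite normc_real// [normc _ * expR _]mulrC.
have inner v t : Cint (fun r => f v (t, r)) =
    psi t * ltransform g w s t * cexp ((s +i* t)%C * v%:C%C).
  rewrite /f /= CintZ; first by rewrite mulrAC.
  apply: (cinteg_le _ ig').
    apply: cmeasurableM; first exact: cmeasurable_real.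
    apply: cmeasurable_cexp; apply: cmeasurableM; first exact: cmeasurable_cst.
    exact: cmeasurable_real.
  by move=> r; rewrite ComplexField.Normc.normcM normc_line_cexp normc_real.
split.
  (* At [v = 0] the inversion exponential is 1, so Fubini yields the integrability of the new [psi]
     itself. *)
  have := cinteg_fubini (mH 0) (H1 0) (Hoo 0) (mf 0) (fH 0).
  under [X in cinteg X -> _]funext do rewrite inner mulr0 cexp0 mulr1.
  exact.
move=> v; under eq_Cint do rewrite -inner.
rewrite (Cint_fubini (mH v) (H1 v) (H2 v) (Hoo v) (mf v) (fH v)).
transitivity (Cint (fun r => (2 * pi * (g r * F (v - w r)))%:C%C)).
  apply: eq_Cint => r.
  transitivity (Cint (fun t => (g r)%:C%C * (psi t * cexp ((s +i* t)%C *
    (v - w r)%:C%C)))).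
    apply: eq_Cint => t; rewrite /f /= realcB mulrBr cexpD mulNr; ring.
  rewrite CintZ; first by rewrite inv -realcM; congr (_ %:C)%C; ring.
  apply: (cinteg_le _ (integZ (expR (s * (v - w r))) ipsi')).
    apply: cmeasurableM; first exact: cinteg_measurable.
    apply: cmeasurable_cexp; apply: cmeasurableM; last exact: cmeasurable_cst.
    by apply: cmeasurable_complex; meas.
  by move=> t; rewrite ComplexField.Normc.normcM normc_line_cexpV mulrC.
by rewrite Cint_real (RintegralZl _ measurableT (i1 v)).
Qed.

End Conv.

End MellinPairs.

(** * The Gamma function *)

Section GammaFunction.
Variable R : realType.
Local Notation mR := (measurableTypeR R).
Local Notation mu := (@lebesgue_measure R).
Local Notation normc := (@ComplexField.Normc.normc R).

Lemma ltransform_loggamma (a s t : R) : s < a ->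
  ltransform (loggamma a) id s t = Gamma (a%:C%C - (s +i* t)%C).
Proof. by move=> sa; rewrite Gamma_loggamma. Qed.

Lemma loggamma_tilt (a s v : R) :
  loggamma a v * expR (- s * v) = loggamma (a - s) v.
Proof. by rewrite mulrC loggammaD addrC. Qed.

Lemma density_loggamma (a s : R) : s < a -> density_at s (loggamma a).
Proof.
move=> sa; have as0 : 0 < a - s by rewrite subr_gt0.
split.
- exact: loggamma_ge0.
- exact: measurable_loggamma.
- by exists (expR ((a - s + 1) ^+ 2 / 2)) => v; rewrite loggamma_tilt loggamma_le.
- under [X in integ X]funext do rewrite loggamma_tilt.
  exact: integ_loggamma.
Qed.

Lemma kernel_halfline (s a : R) : 0 < a -> s = - a ->
  kernel_at s (fun r => (0 < r)%R%:R) (fun r => - r).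
Proof.
move=> a0 ->; split.
- by move=> r; rewrite ler0n.
- exact: measurable_gt0.
- by meas.
- under [X in integ X]funext => r do rewrite opprK mulrN -mulNr.
  exact: integ_gt0_exp.
Qed.

(** [loggamma 1] is the derivative of [- e^{- e^v}], that is, of minus [loggamma 0]. The decay at
    infinity has rate [e^v] because [e^{v + r} >= e^v r]. *)
Lemma logconv_halfline (v : R) :
  logconv (fun r => (0 < r)%R%:R) (fun r => - r) (loggamma 1) v = loggamma 0 v.
Proof.
have dv (x : R) : is_derive x 1 (fun r => v + r) 1.
  apply: (is_derive_eq (is_derive_addf (is_derive_cst v x 1) (is_derive_id x 1))).
  by rewrite add0r.
have de (x : R) : is_derive x 1 (fun r => expR (v + r)) (expR (v + x)).
  apply: (is_derive_eq (is_derive1_comp (is_derive_expR (v + x)) (dv x))).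
  by rewrite mulr1.
have dF (x : R) : is_derive x 1 (fun r => - expR (- expR (v + r))) (loggamma 1 (v + x)).
  have dN := is_derive_scalef (- 1) (de x).
  have dE := @is_derive1_comp R (@expR R) (fun y => -1 * expR (v + y)) x _ _
    (is_derive_expR (- 1 * expR (v + x))) dN.
  have := is_derive_scalef (- 1) dE; rewrite /comp => D.
  apply: (is_derive_eq (_ : is_derive x 1 _ (- 1 * (expR (-1 * expR (v + x)) *
    (-1 * expR (v + x)))))).
    rewrite (_ : (fun r => - expR (- expR (v + r))) = fun r => -1 * expR
      (-1 * expR (v + r)))//.
    by apply/funext => r; rewrite !mulN1r.
  by rewrite /loggamma [RHS]expRD !mulN1r mulrN opprK mul1r mulrC.
have cf : continuous (fun r => loggamma 1 (v + r)).
  move=> x; apply: (@continuous_comp _ _ _ (fun r : R => v + r) (loggamma 1));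
    last exact: continuous_loggamma.
  by apply: cvgD; [exact: cvg_cst|exact: cvg_id].
rewrite /logconv; under eq_Rintegral do rewrite opprK.
rewrite /Rintegral (integral_gt0_FTC (C := 1) (l := 0) (expR_gt0 v) _ cf dF).
- by rewrite addr0 sub0r opprK/= /loggamma mul0r sub0r.
- by move=> x _; exact: loggamma_ge0.
- move=> x x0; rewrite subr0 normrN ger0_norm ?expR_ge0// mul1r ler_expR lerN2.
  rewrite expRD ler_pM2l ?expR_gt0//; have := expR_ge1Dx x; lra.
Qed.

(* e^{-e^v} is the integral of e^{v + r - e^{v + r}} over r > 0, that is, a
   convolution whose transform is the product of Gamma (z + 1) and 1 / z. *)
Lemma GammaS (z : R[i]) : 0 < complex.Re z -> Gamma (z + 1) = z * Gamma z.
Proof.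
case: z => a b /= a0; have sa : - a < 0 by rewrite oppr_lt0.
have sa1 : - a < 1 by rewrite (lt_trans sa).
(* At the point [- a - i b] the three transforms are [Gamma z], [Gamma (z + 1)] and [1 / z]. *)
have := ltransform_logconv (kernel_halfline a0 erefl) (density_loggamma sa1) (- b).
rewrite (_ : logconv _ _ _ = loggamma 0); last first.
  by apply/funext => v; exact: logconv_halfline.
rewrite !ltransform_loggamma//.
rewrite (_ : 0%:C%C - (- a +i* - b)%C = (a +i* b)%C); last first.
  by apply: complexP; rewrite /= ?sub0r ?add0r opprK.
rewrite (_ : 1%:C%C - (- a +i* - b)%C = (a +i* b)%C + 1); last first.
  by apply: complexP; rewrite /= ?opprK ?add0r ?addr0// addrC.
rewrite (_ : ltransform _ _ _ _ = ((a +i* b)%C)^-1); last first.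
  rewrite -(Cint_laplace b a0); apply: eq_Cint => r; congr (_ * cexp _).
  by apply: complexP; rewrite /=; ring.
move=> ->; rewrite mulrCA mulfV ?mulr1//.
by apply/eqP => /(congr1 (@complex.Re R))/= /eqP; rewrite gt_eqF.
Qed.

Lemma Rintegral_loggammaS (a : R) : 0 < a ->
  \int[mu]_v loggamma (a + 1) v = a * \int[mu]_v loggamma a v.
Proof.
move=> a0; apply: (@complexI R); rewrite realcM -!Gamma_real ?addr_gt0//.
by rewrite realcD GammaS.
Qed.

Lemma abs_sin_le (x : R) : `|sin x| <= `|x|.
Proof.
wlog x0 : x / 0 <= x => [hw|].
  have [/hw//|/ltW x0] := leP 0 x.
  by rewrite -normrN -sinN -[leRHS]normrN hw// oppr_ge0.
have [->|xn0] := eqVneq x 0; first by rewrite sin0.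
have xgt0 : 0 < x by rewrite lt_neqAle eq_sym xn0.
have [c _] := @MVT R (@sin R) (@cos R) 0 x xgt0
  (fun y _ => is_derive_sin y) (continuous_subspaceT (@continuous_sin R)).
rewrite sin0 !subr0 => ->; rewrite normrM ler_piMl//.
exact: cos_max.
Qed.

Lemma cos_ge (y : R) : 1 - y ^+ 2 / 2 <= cos y.
Proof.
have e : cos y = 1 - 2 * sin (y / 2) ^+ 2.
  rewrite [in LHS](_ : y = (y / 2) *+ 2); last by rewrite mulr2n; field.
  by rewrite cos_mulr2n sin2cos2; ring.
rewrite e lerD2l lerN2; have := abs_sin_le (y / 2).
move=> /(lerXn2r 2 (normr_ge0 _) (normr_ge0 _)).
rewrite !real_normK ?num_real//; lra.
Qed.

(** The right-hand side is [4 (e^{u/2} - e^{-u/2})^2], and for [u >= 0] the difference is at least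
    [u / 2]. A bound in [e^u] and [e^{-u}] is wanted because these factors shift the parameter of
    [loggamma] by one. *)
Lemma sqr_le_cosh (u : R) : u ^+ 2 <= 4 * (expR u - 2 + expR (- u)).
Proof.
wlog u0 : u / 0 <= u => [hw|].
  have [/hw//|/ltW u0] := leP 0 u.
  have := hw (- u); rewrite oppr_ge0 => /(_ u0); rewrite sqrrN opprK; lra.
have e1 : expR u = expR (u / 2) ^+ 2.
  by rewrite -expRM_natl; congr expR; field.
have e2 : expR (- u) = expR (- (u / 2)) ^+ 2.
  by rewrite -expRM_natl; congr expR; field.
have e3 := expRxMexpNx_1 (u / 2).
have h1 := expR_ge1Dx (u / 2).
have h2 : expR (- (u / 2)) <= 1 by rewrite expR_le1 oppr_le0 divr_ge0.
have h3 : u / 2 <= expR (u / 2) - expR (- (u / 2)) by lra.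
have h4 : 0 <= u / 2 by rewrite divr_ge0.
rewrite e1 e2; nra.
Qed.

(* For U with the Gamma(x) law, ln U concentrates at ln x as x grows:
   E cos (t (ln U - ln x)) >= 1 - 2 t^2 E (U/x - 2 + x/U) = 1 - 2 t^2 / (x - 1). *)
Lemma Gamma_neq0_large (x t : R) : 1 + 2 * t ^+ 2 < x -> Gamma (x +i* t)%C != 0.
Proof.
move=> xt; have x1 : 1 < x by have := sqr_ge0 t; lra.
have x0 : 0 < x by lra.
pose c := ln x; have ec : expR c = x by rewrite lnK.
apply/eqP => G0.
have : Gamma (x%:C%C - (0 +i* (- t))%C) = 0.
  by rewrite -G0; congr Gamma; apply: complexP; rewrite /= ?subr0 ?opprK ?add0r.
rewrite Gamma_loggamma// => I0.
have ih := integ_loggamma x0; have mh := measurable_loggamma x.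
have ci : cinteg (fun v => (loggamma x v)%:C%C * cexp (- (0 +i* - t)%C * v%:C%C)).
  apply: (cinteg_le _ ih).
    apply: cmeasurableM; first exact: cmeasurable_real.
    apply: cmeasurable_cexp; apply: cmeasurableM; first exact: cmeasurable_cst.
    by apply: cmeasurable_real; meas.
  move=> v; rewrite ComplexField.Normc.normcM normc_line_cexp.
  by rewrite normc_real ?loggamma_ge0// oppr0 mul0r expR0 mulr1.
(* Rotating the phase centres the cosine at the concentration point [c = ln x]; the integral stays
   zero. *)
have := CintZ (cexp (0 +i* (- (t * c)))%C) ci; rewrite I0 mulr0.
move=> /(congr1 (@complex.Re R)) Jr.
have {Jr} : \int[mu]_v (loggamma x v * cos (t * (v - c))) = 0.
  rewrite -[RHS]/(complex.Re (0 : R[i])) -Jr; apply: eq_Rintegral => v _;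
    rewrite mulrCA -cexpD ReM ImC mul0r subr0.
  rewrite ReC cexpE /= !(mul0r, mulr0, oppr0, opprK, addr0, add0r, subr0) expR0 mul1r.
  by congr (_ * cos _); ring.
apply/eqP; rewrite gt_eqF//.
have i1 := integ_loggamma (addr_gt0 x0 ltr01).
have xm0 : 0 < x - 1 by rewrite subr_gt0.
have i2 := integ_loggamma xm0.
have e1 := Rintegral_loggammaS x0.
have e2 := Rintegral_loggammaS xm0; rewrite subrK in e2.
have Ix := Rintegral_loggamma_gt0 x0.
(* With [u = v - c], [cos_ge] and [sqr_le_cosh] give [cos (t u) >= 1 - k (e^u - 2 + e^{-u})].
   Against [loggamma x] the right-hand side integrates to [1 - k / (x - 1)] times the total mass,
   which is positive exactly because [x > 1 + k]. *)
pose k := 2 * t ^+ 2.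
apply: (@lt_le_trans _ _ (\int[mu]_v ((1 + 2 * k) * loggamma x v -
    (k / x * loggamma (x + 1) v + k * x * loggamma (x - 1) v)))).
  rewrite RintegralB//; [|exact: integZ|by apply: integD; exact: integZ].
  rewrite RintegralD//; [|exact: integZ|exact: integZ].
  rewrite !RintegralZl// e1 e2.
  have e3 : (x - 1)^-1 * \int[mu]_v loggamma x v = \int[mu]_v loggamma (x - 1) v.
    by rewrite e2 mulKf// gt_eqF.
  rewrite -e2 -e3.
  set I := \int[mu]_v loggamma x v in Ix *.
  rewrite (_ : _ - _ = (1 - k / (x - 1)) * I); last by field; rewrite !gt_eqF.
  by rewrite mulr_gt0// subr_gt0 ltr_pdivrMr// mul1r /k; lra.
apply: le_Rintegral => //.
- exact: (integB (integZ _ ih) (integD (integZ _ i1) (integZ _ i2))).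
- apply: (integ_le _ ih).
    apply: measurable_funM => //; apply: (measurableT_comp (f := @cos R)).
      by apply: continuous_measurable_fun; exact: continuous_cos.
    by meas.
  move=> v; rewrite normrM ger0_norm ?loggamma_ge0// ler_piMr ?loggamma_ge0//.
  exact: cos_max.
move=> v _; have h0 := loggamma_ge0 x v.
have fE a : loggamma (x + a) v = loggamma x v * expR (a * v).
  by rewrite mulrC loggammaD addrC.
have f1 : loggamma (x + 1) v = loggamma x v * (expR (v - c) * x).
  by rewrite fE mul1r expRB ec divfK ?gt_eqF.
have f2 : loggamma (x - 1) v = loggamma x v * (expR (- (v - c)) / x).
  rewrite fE mulN1r opprB expRB ec expRN; congr (_ * _); field.
  by rewrite !gt_eqF ?expR_gt0.
rewrite f1 f2.
rewrite (_ : _ - _ = loggamma x v * (1 - k * (expR (v - c) - 2 + expR (- (v - c)))));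
  last by field; rewrite gt_eqF.
apply: ler_wpM2l => //; apply: le_trans (cos_ge _).
rewrite lerD2l lerN2 exprMn; have := sqr_le_cosh (v - c).
have := sqr_ge0 t; rewrite /k; nra.
Qed.

(** The functional equation would propagate a zero at [z] to every [z + n], with unchanged imaginary
    part, until [Gamma_neq0_large] forbids it. *)
Lemma Gamma_neq0 (z : R[i]) : 0 < complex.Re z -> Gamma z != 0.
Proof.
case: z => x t /= x0; apply/eqP => G0.
have Gn n : Gamma ((x + n%:R) +i* t)%C = 0.
  elim: n => [|n IH]; first by rewrite addr0.
  rewrite (_ : (_ +i* _)%C = ((x + n%:R) +i* t)%C + 1); last first.
    by apply: complexP; rewrite /= ?addr0// -addrA natr1.
  by rewrite GammaS ?IH ?mulr0//= ltr_wpDr.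
have [n Hn] : exists n : nat, 1 + 2 * t ^+ 2 < n%:R.
  by exists (Num.truncn (1 + 2 * t ^+ 2)).+1; rewrite truncnS_gt.
by have := @Gamma_neq0_large (x + n%:R) t; rewrite Gn eqxx; move=> /(_ _)/negP;
  apply => //;
   rewrite (lt_le_trans Hn)// lerDr ltW.
Qed.

End GammaFunction.

(** * The Cahen-Mellin integral *)

Section CahenMellin.
Variable R : realType.
Local Notation mR := (measurableTypeR R).
Local Notation mu := (@lebesgue_measure R).
Local Notation normc := (@ComplexField.Normc.normc R).

(** Damping by [e^{-|t|}] makes the integrand integrable in [(t, r)]; Fubini then makes the damped
    transform integrable, hence measurable, and multiplying by [e^{|t|}] removes the damping. *)
Lemma cmeasurable_ltransform (s : R) (g w : R -> R) : kernel_at s g w ->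
  cmeasurable (ltransform g w s : mR -> R[i]).
Proof.
move=> [g0 mg mw ig].
pose f (z : mR * mR) := (expR (- 1 * `|z.1|))%:C%C *
  ((g z.2)%:C%C * cexp (- (s +i* z.1)%C * (w z.2)%:C%C)).
pose G (z : mR * mR) := expR (- 1 * `|z.1|) * (g z.2 * expR (- s * w z.2)).
have mG : measurable_fun setT G.
  by rewrite /G; meas; [exact: (measurableT_comp mg)|exact: (measurableT_comp mw)].
have mf : cmeasurable f.
  apply: cmeasurableM; first by apply: cmeasurable_real; meas.
  apply: cmeasurableM; first by apply: cmeasurable_real; exact: (measurableT_comp mg).
  apply: cmeasurable_cexp; apply: cmeasurableM; last first.
    by apply: cmeasurable_real; exact: (measurableT_comp mw).
  by apply: cmeasurable_complex; meas.
have fG z : normc (f z) <= G z.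
  rewrite /f ComplexField.Normc.normcM (ComplexField.Normc.normcM (g z.2)%:C%C).
  by rewrite normc_line_cexp !normc_real ?expR_ge0.
have cg t : cinteg (fun r => (g r)%:C%C * cexp (- (s +i* t)%C * (w r)%:C%C)).
  apply: (cinteg_le _ ig).
    apply: cmeasurableM; first exact: cmeasurable_real.
    apply: cmeasurable_cexp; apply: cmeasurableM; first exact: cmeasurable_cst.
    exact: cmeasurable_real.
  by move=> r; rewrite ComplexField.Normc.normcM normc_line_cexp normc_real.
have Goo : (\int[mu]_x \int[mu]_y (G (x, y))%:E < +oo)%E.
  apply: (integral_tensor_lty (integ_exp_abs ltr01) ig).
    by move=> x; exact: expR_ge0.
  by move=> x; rewrite mulr_ge0 ?expR_ge0.
have := cinteg_measurable (cinteg_fubini mG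
  (fun x => integZ (expR (- 1 * `|x|)) ig) Goo mf fG).
have mE : cmeasurable (fun t : mR => (expR `|t|)%:C%C).
  by apply: cmeasurable_real; meas.
move=> /(cmeasurableM mE); congr cmeasurable; apply/funext => t.
rewrite /f/= CintZ// mulrA -realcM -expRD mulN1r subrr expR0 mul1r.
by [].
Qed.

Lemma continuous_inv_oneDsqr : continuous (fun x : R => (1 + x ^+ 2)^-1).
Proof.
move=> x; apply: cvgV; first by rewrite gt_eqF// ltr_pwDl// sqr_ge0.
by apply: cvgD; [exact: cvg_cst|apply: exprn_continuous].
Qed.

Lemma integral_inv_oneDsqr :
  (\int[mu]_x ((1 + x ^+ 2)^-1)%:E = (pi : R)%:E)%E.
Proof.
rewrite ge0_symfun_integralT//.
- rewrite -set_itvcy (_ : \int[mu]_(x in _) _ = (pi / 2)%:E)%E; last first.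
    exact: integral0y_oneDsqr.
  by rewrite -EFinM; congr EFin; field.
- by move=> x; rewrite invr_ge0 addr_ge0// sqr_ge0.
- exact: continuous_inv_oneDsqr.
- by move=> x /=; rewrite sqrrN.
Qed.

Lemma integ_inv_oneDsqr : integ (fun x : R => (1 + x ^+ 2)^-1).
Proof.
apply/integP; last by rewrite integral_inv_oneDsqr ltry.
  by apply: continuous_measurable_fun; exact: continuous_inv_oneDsqr.
by move=> x; rewrite invr_ge0 addr_ge0// sqr_ge0.
Qed.

(** [Gamma z = Gamma (z + 2) / (z (z + 1))], where the numerator is bounded on the vertical line and
    [|z (z + 1)| >= |z|^2 = b^2 + t^2 >= min(b^2, 1) (1 + t^2)]. *)
Lemma Gamma_decay (b : R) : 0 < b ->
  exists C, forall t, normc (Gamma (b +i* t)%C) <= C * (1 + t ^+ 2)^-1.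
Proof.
move=> b0; have b20 : 0 < b + 2 by rewrite addr_gt0.
pose K := 2 * \int[mu]_v loggamma (b + 2) v.
have K0 : 0 <= K by rewrite mulr_ge0// ltW// Rintegral_loggamma_gt0.
pose m := Num.min (b ^+ 2) 1.
have m0 : 0 < m by rewrite lt_min exprn_gt0/=.
exists (K / m) => t; set z := (b +i* t)%C.
have GK : normc (Gamma (z + 1 + 1)) <= K.
  rewrite (_ : z + 1 + 1 = (b + 2)%:C%C - (0 +i* (- t))%C); last first.
    by apply: complexP; rewrite /= ?subr0 ?opprK ?add0r ?addr0// -addrA.
  rewrite Gamma_loggamma//; apply: normc_Cint => //; last 2 first.
  - exact: integ_loggamma.
  - move=> v; rewrite ComplexField.Normc.normcM normc_line_cexp.
    by rewrite normc_real ?loggamma_ge0// oppr0 mul0r expR0 mulr1.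
  apply: (cinteg_le _ (integ_loggamma b20)).
    apply: cmeasurableM.
      by apply: cmeasurable_real; exact: measurable_loggamma.
    apply: cmeasurable_cexp; apply: cmeasurableM; first exact: cmeasurable_cst.
    by apply: cmeasurable_real; meas.
  move=> v; rewrite ComplexField.Normc.normcM normc_line_cexp.
  by rewrite normc_real ?loggamma_ge0// oppr0 mul0r expR0 mulr1.
move: GK; rewrite GammaS; last by rewrite /= addr_gt0.
rewrite GammaS// ComplexField.Normc.normcM (ComplexField.Normc.normcM z) => GK.
pose N := Num.sqrt (b ^+ 2 + t ^+ 2).
have N2 : N ^+ 2 = b ^+ 2 + t ^+ 2 by rewrite sqr_sqrtr// addr_ge0// sqr_ge0.
have N0 : 0 <= N by exact: sqrtr_ge0.
have zN : normc z = N by [].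
have z1N : N <= normc (z + 1).
  rewrite /= addr0 ler_sqrt ?addr_ge0 ?sqr_ge0// lerD2r; nra.
set X := normc (Gamma z) in GK *; have X0 : 0 <= X by exact: normc_ge0.
have XN : X * N ^+ 2 <= K.
  apply: le_trans GK; rewrite zN (_ : X * N ^+ 2 = N * (N * X)); last by ring.
  by rewrite ler_wpM2r// mulr_ge0.
have mN : m * (1 + t ^+ 2) <= N ^+ 2.
  have m1 : m <= b ^+ 2 by rewrite ge_min lexx.
  have m2 : m <= 1 by rewrite ge_min lexx orbT.
  rewrite N2; have := sqr_ge0 t; nra.
have t0 : 0 < 1 + t ^+ 2 by rewrite ltr_pwDl// sqr_ge0.
rewrite -mulrA -invfM ler_pdivlMr ?mulr_gt0//.
by apply: le_trans XN; rewrite ler_wpM2l.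
Qed.

Lemma cinteg_Gamma_line (a s : R) : s < a ->
  cinteg (fun t => Gamma (a%:C%C - (s +i* t)%C)).
Proof.
move=> sa; have as0 : 0 < a - s by rewrite subr_gt0.
have [C HC] := Gamma_decay as0.
apply: (cinteg_le _ (integZ C integ_inv_oneDsqr)).
  have := cmeasurable_ltransform (density_kernel (density_loggamma sa)).
  by congr cmeasurable; apply/funext => t; rewrite ltransform_loggamma.
move=> t; rewrite (_ : _ - _ = ((a - s) +i* (- t))%C).
  by rewrite -[t ^+ 2]sqrrN.
by apply: complexP; rewrite /= ?sub0r.
Qed.

Lemma Rintegral_dominated (f_ : nat -> R -> R) (f g : R -> R) :
  (forall n, measurable_fun [set: mR] (f_ n)) -> measurable_fun [set: mR] f ->
  (forall x, f_ n x @[n --> \oo] --> f x) -> integ g ->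
  (forall n x, `|f_ n x| <= g x) ->
  \int[mu]_x f_ n x @[n --> \oo] --> \int[mu]_x f x.
Proof.
move=> mf_ mf ff ig fg.
have ffE x : (f_ n x)%:E @[n --> \oo] --> (f x)%:E.
  by apply: cvg_EFin; [exact: nearW|exact: ff].
have h1 : {ae mu, forall x, [set: mR] x ->
    (f_ n x)%:E @[n --> \oo] --> (EFin \o f) x}.
  by apply: aeW => x _; exact: ffE.
have h2 : {ae mu, forall x n, [set: mR] x -> (`|(f_ n x)%:E| <= (EFin \o g) x)%E}.
  by apply: aeW => x n _; rewrite lee_fin.
have [i1 _ i3] := @dominated_convergence _ mR R mu setT measurableT
  (fun n x => (f_ n x)%:E) (EFin \o f) (EFin \o g)
  (fun n => (measurable_EFinP _ _).2 (mf_ n)) ((measurable_EFinP _ _).2 mf)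
  h1 ig h2.
move: i3; rewrite -[X in _ --> X]fineK; last exact: integrable_fin_num.
exact: fine_cvg.
Qed.

(** The damping allows Euler's integral and the line integral to be swapped; the inner integral is
    then the Poisson kernel at [v - x]. Substituting [x = v + e u] turns the kernel into a fixed one
    and moves [e] into the argument of [loggamma]. *)
Lemma poisson_regularization (b e v : R) : 0 < b -> 0 < e ->
  Cint (fun t => Gamma (b%:C%C - (0 +i* t)%C) * cexp ((0 +i* t)%C * v%:C%C) *
    (expR (- e * `|t|))%:C%C) =
  (\int[mu]_u (loggamma b (v + e * u) * (2 * (1 + u ^+ 2)^-1)))%:C%C.
Proof.
move=> b0 e0; have ih := integ_loggamma b0.
have mh := measurable_loggamma b.
pose f (z : mR * mR) := ((loggamma b z.1)%:C%C * cexp (- (0 +i* z.2)%C * z.1%:C%C)) *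
  (cexp ((0 +i* z.2)%C * v%:C%C) * (expR (- e * `|z.2|))%:C%C).
pose G (z : mR * mR) := loggamma b z.1 * expR (- e * `|z.2|).
have mG : measurable_fun setT G.
  by rewrite /G; meas; exact: (measurableT_comp mh).
have mf : cmeasurable f.
  apply: cmeasurableM; apply: cmeasurableM.
  - by apply: cmeasurable_real; exact: (measurableT_comp mh).
  - apply: cmeasurable_cexp; apply: cmeasurableM; last by apply: cmeasurable_real; meas.
    by apply: cmeasurable_complex; meas.
  - apply: cmeasurable_cexp; apply: cmeasurableM; last exact: cmeasurable_cst.
    by apply: cmeasurable_complex; meas.
  - by apply: cmeasurable_real; meas.
have fG z : normc (f z) <= G z.
  rewrite /f ComplexField.Normc.normcM (ComplexField.Normc.normcM (loggamma _ _)%:C%C).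
  rewrite (ComplexField.Normc.normcM (cexp _)) normc_line_cexp normc_line_cexpV.
  rewrite !normc_real ?expR_ge0 ?loggamma_ge0//.
  by rewrite oppr0 !mul0r expR0 mul1r mulr1.
have Goo : (\int[mu]_x \int[mu]_y (G (x, y))%:E < +oo)%E.
  apply: (integral_tensor_lty ih (integ_exp_abs e0)); first exact: loggamma_ge0.
  by move=> x; exact: expR_ge0.
have G2 y : integ (fun x => G (x, y)).
  rewrite (_ : (fun x => _) = fun x => expR (- e * `|y|) * loggamma b x).
    exact: (integZ _ ih).
  by apply/funext => x; rewrite /G mulrC.
transitivity (Cint (fun t => Cint (fun x => f (x, t)))).
  apply: eq_Cint => t; rewrite /f/= -mulrA mulrC.
  rewrite Gamma_loggamma// -CintZ.
    by apply: eq_Cint => x; rewrite mulrC.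
  apply: (cinteg_le _ ih).
    apply: cmeasurableM; first exact: cmeasurable_real.
    apply: cmeasurable_cexp; apply: cmeasurableM; first exact: cmeasurable_cst.
    by apply: cmeasurable_real; meas.
  move=> x; rewrite ComplexField.Normc.normcM normc_line_cexp.
  by rewrite normc_real ?loggamma_ge0// oppr0 mul0r expR0 mulr1.
rewrite -(Cint_fubini mG (fun x => integZ (loggamma b x)
  (integ_exp_abs e0)) G2 Goo mf fG).
transitivity (Cint (fun x => (loggamma b x * (2 * e / (e ^+ 2 + (v - x) ^+ 2)))%:C%C)).
  apply: eq_Cint => x; rewrite realcM -Cint_poisson// -CintZ; last first.
    apply: (cinteg_le _ (integ_exp_abs e0)).
      apply: cmeasurableM; first by apply: cmeasurable_real; meas.
      by apply: cmeasurable_cexp; apply: cmeasurable_complex; meas.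
    move=> t; rewrite ComplexField.Normc.normcM normc_real ?expR_ge0//.
    by rewrite normc_cexp /= expR0 mulr1.
  apply: eq_Cint => t; rewrite /f/=.
  rewrite (_ : (0 +i* (t * (v - x)))%C =
      - (0 +i* t)%C * x%:C%C + (0 +i* t)%C * v%:C%C); last first.
    by apply: complexP; rewrite /=; ring.
  by rewrite cexpD; ring.
rewrite Cint_real; congr (_%:C)%C; congr fine.
have p0 x : 0 <= loggamma b x * (2 * e / (e ^+ 2 + (v - x) ^+ 2)).
  by rewrite mulr_ge0 ?loggamma_ge0// divr_ge0 ?mulr_ge0 ?(ltW e0)// ?addr_ge0 ?sqr_ge0.
have mp : measurable_fun [set: mR] (fun x => loggamma b x * (2 * e / (e ^+ 2 +
  (v - x) ^+ 2))).
  apply: measurable_funM => //; apply: continuous_measurable_fun => x.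
  apply: cvgM; first exact: cvg_cst.
  apply: cvgV; first by rewrite gt_eqF// ltr_pwDl ?exprn_gt0// sqr_ge0.
  apply: cvgD; first exact: cvg_cst.
  apply: (@continuous_comp _ _ _ (fun x : R => v - x) (fun y => y ^+ 2));
    last exact: exprn_continuous.
  by apply: cvgB; [exact: cvg_cst|exact: cvg_id].
rewrite (ge0_integral_affine v e0); [|exact/measurable_EFinP|by move=> x;
  rewrite lee_fin].
rewrite -ge0_integralZl//; last 3 first.
- apply/measurable_EFinP; apply: (measurableT_comp mp); meas.
- by move=> x _; rewrite lee_fin.
- by rewrite lee_fin ltW.
apply: eq_integral => u _; rewrite -EFinM; congr EFin.
rewrite addrC; set h := loggamma b _; field.
by rewrite !gt_eqF ?ltr_pwDl ?sqr_ge0 ?exprn_gt0.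
Qed.

(** Let [e = 1 / (n + 1)] tend to 0 in [poisson_regularization]. The left side converges by
    domination, Gamma being integrable on the line; the right side because [loggamma b] is bounded
    and continuous, with [2 / (1 + u^2)] of integral [2 pi]. *)
Lemma cahen_mellin0 (b : R) : 0 < b ->
  inversion_at 0 (fun t => Gamma (b%:C%C - (0 +i* t)%C)) (loggamma b).
Proof.
move=> b0; have cG := cinteg_Gamma_line b0; split=> // v.
pose e n : R := n.+1%:R^-1.
have e0 n : 0 < e n by rewrite invr_gt0 ltr0n.
have ecvg : e n @[n --> \oo] --> (0 : R) by exact: cvg_harmonic.
set p := fun t => Gamma (b%:C%C - (0 +i* t)%C) * cexp ((0 +i* t)%C * v%:C%C).
have cp : cinteg p.
  apply: (cinteg_le _ (integ_normc cG)).
    apply: cmeasurableM; first exact: cinteg_measurable.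
    apply: cmeasurable_cexp; apply: cmeasurableM; last exact: cmeasurable_cst.
    by apply: cmeasurable_complex; meas.
  by move=> t; rewrite /p ComplexField.Normc.normcM normc_line_cexpV mul0r expR0 mulr1.
have reg q : integ q -> \int[mu]_t (q t * expR (- e n * `|t|)) @[n --> \oo] -->
    \int[mu]_t q t.
  move=> iq; apply: (Rintegral_dominated (g := fun t => `|q t|)).
  - by move=> n; apply: measurable_funM; [exact: integ_measurable|meas].
  - exact: integ_measurable.
  - move=> t; have et : - e n * `|t| @[n --> \oo] --> (0 : R).
      suff : - e n * `|t| @[n --> \oo] --> - 0 * `|t| by rewrite oppr0 mul0r.
      by apply: cvgMl; exact: cvgN.
    rewrite -[X in _ --> X]mulr1; apply: cvgMr.
    rewrite -[X in _ --> X](@expR0 R).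
    apply: (@cvg_comp _ _ _ (fun n => - e n * `|t|) (@expR R) _ (nbhs (0 : R))).
      exact: et.
    exact: continuous_expR.
  - exact: integ_normr.
  - move=> n t; rewrite normrM ler_piMr// ger0_norm ?expR_ge0// expR_le1.
    by rewrite mulNr oppr_le0 mulr_ge0// ltW.
have regE n := poisson_regularization v b0 (e0 n).
have rhs : \int[mu]_u (loggamma b (v + e n * u) * (2 * (1 + u ^+ 2)^-1))
    @[n --> \oo] --> 2 * pi * loggamma b v.
  have -> : 2 * pi * loggamma b v = \int[mu]_u (loggamma b v * 2 * (1 + u ^+ 2)^-1).
    rewrite RintegralZl//; last exact: integ_inv_oneDsqr.
    rewrite [X in _ = _ * X](_ : _ = pi); first by ring.
    by rewrite /Rintegral integral_inv_oneDsqr.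
  have mi := integ_measurable integ_inv_oneDsqr.
  apply: (Rintegral_dominated
    (g := fun u => expR ((b + 1) ^+ 2 / 2) * 2 * (1 + u ^+ 2)^-1)).
  - move=> n; apply: measurable_funM; last by meas.
    by apply: (measurableT_comp (measurable_loggamma b)); meas.
  - by meas.
  - move=> u; rewrite -mulrA; apply: cvgMl.
    have et : v + e n * u @[n --> \oo] --> v.
      suff : v + e n * u @[n --> \oo] --> v + 0 * u by rewrite mul0r addr0.
      by apply: cvgD; [exact: cvg_cst|exact: cvgMl].
    apply: (@cvg_comp _ _ _ (fun n => v + e n * u) (loggamma b) _ (nbhs v)).
      exact: et.
    exact: continuous_loggamma.
  - exact: (integZ _ integ_inv_oneDsqr).
  - move=> n u; rewrite ger0_norm; last first.
      by rewrite !mulr_ge0 ?loggamma_ge0// invr_ge0 addr_ge0// sqr_ge0.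
    rewrite mulrA !ler_wpM2r ?loggamma_le// ?invr_ge0 ?addr_ge0 ?sqr_ge0//.
apply: complexP.
- rewrite ReC; apply: (cvg_unique _ (reg _ cp.1)) => //.
  apply: cvg_trans rhs; apply: near_eq_cvg; apply: nearW => n.
  apply: etrans (esym (congr1 (@complex.Re R) (regE n))) _.
  by apply: eq_Rintegral => t _; rewrite ReM ImC mulr0 subr0.
- rewrite ImC; apply: (cvg_unique _ (reg _ cp.2)) => //.
  suff -> : (fun n => \int[mu]_t (complex.Im (p t) * expR (- e n * `|t|))) =
      fun=> 0 by exact: cvg_cst.
  apply/funext => n; apply: etrans _ (congr1 (@complex.Im R) (regE n)).
  by apply: eq_Rintegral => t _; rewrite ImM ImC mulr0 add0r.
Qed.

(** Reduced to abscissa 0 with parameter [a - s], since [e^{s v}] times [loggamma (a - s) v] is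
    [loggamma a v]. *)
Lemma cahen_mellin (a s : R) : s < a ->
  inversion_at s (fun t => Gamma (a%:C%C - (s +i* t)%C)) (loggamma a).
Proof.
move=> sa; have as0 : 0 < a - s by rewrite subr_gt0.
split=> [|v]; first exact: cinteg_Gamma_line.
have [cG inv] := cahen_mellin0 as0.
have E t : (a%:C%C - (s +i* t)%C) = ((a - s)%:C%C - (0 +i* t)%C).
  by apply: complexP; rewrite /= ?subr0.
transitivity (Cint (fun t => (expR (s * v))%:C%C *
    (Gamma ((a - s)%:C%C - (0 +i* t)%C) * cexp ((0 +i* t)%C * v%:C%C)))).
  apply: eq_Cint => t; rewrite E [RHS]mulrCA -cexp_real -cexpD; congr (_ * cexp _).
  by apply: complexP; rewrite /=; ring.
rewrite CintZ; last first.
  apply: (cinteg_le _ (integ_normc cG)).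
    apply: cmeasurableM; first exact: cinteg_measurable.
    apply: cmeasurable_cexp; apply: cmeasurableM; last exact: cmeasurable_cst.
    by apply: cmeasurable_complex; meas.
  by move=> t; rewrite ComplexField.Normc.normcM normc_line_cexpV mul0r expR0 mulr1.
rewrite inv -realcM mulrCA loggammaD.
by rewrite addrC subrK.
Qed.

End CahenMellin.

(** * The law of the SNR and of products of SNRs *)

Section BetaKernel.
Variable R : realType.
Local Notation mR := (measurableTypeR R).
Local Notation mu := (@lebesgue_measure R).

Definition softplus (r : R) : R := ln (1 + expR r).

Lemma expR_softplus r : expR (softplus r) = 1 + expR r.
Proof. by rewrite lnK// posrE addr_gt0 ?expR_gt0. Qed.

Lemma softplus_ge0 r : 0 <= softplus r.
Proof. by rewrite ln_ge0// lerDl expR_ge0. Qed.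

Lemma softplus_ge r : r <= softplus r.
Proof. by rewrite -ler_expR expR_softplus lerDr. Qed.

Lemma measurable_softplus : measurable_fun [set: mR] (softplus : mR -> R).
Proof. by rewrite /softplus; meas. Qed.

(* With u = 1 / (1 + e^r), this is the Beta(om, 1/2) law in the variable ln u,
   up to a factor Gamma(om) / Gamma(om + 1/2). *)
Definition betakernel (om r : R) : R :=
  (\int[mu]_v loggamma 2^-1 v)^-1 * expR (2^-1 * r - (om + 2^-1) * softplus r).

Lemma half_gt0 : 0 < 2^-1 :> R. Proof. by rewrite invr_gt0. Qed.

(** The tilted exponent is [r / 2 - (om - s + 1/2) softplus r]. From [softplus r >= r] it is at most
    [- (om - s) r] for [r >= 0], and from [softplus r >= 0] at most [r / 2] for [r < 0]. *)
Lemma kernel_beta (s om : R) : s < om ->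
  kernel_at s (betakernel om) (fun r => - softplus r).
Proof.
move=> som; have d0 : 0 < om - s by rewrite subr_gt0.
have I0 := Rintegral_loggamma_gt0 half_gt0.
have m0 : 0 < Num.min (om - s) 2^-1 by rewrite lt_min d0 half_gt0.
have mw := measurable_softplus.
have mg : measurable_fun [set: mR] (betakernel om : mR -> R).
  by rewrite /betakernel; meas.
split => //.
- by move=> r; rewrite mulr_ge0 ?expR_ge0// invr_ge0 ltW.
- exact: measurable_funN.
apply: (integ_le _ (integZ (\int[mu]_v loggamma 2^-1 v)^-1 (integ_exp_abs m0))).
  by meas.
move=> r; rewrite ger0_norm; last first.
  by rewrite !mulr_ge0 ?expR_ge0// invr_ge0 ltW.
rewrite -mulrA -expRD ler_wpM2l ?invr_ge0 ?(ltW I0)// ler_expR.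
have m1 : Num.min (om - s) 2^-1 <= om - s by rewrite ge_min lexx.
have m2 : Num.min (om - s) 2^-1 <= 2^-1 by rewrite ge_min lexx orbT.
have h1 := softplus_ge0 r; have h2 := softplus_ge r.
set m := Num.min _ _ in m0 m1 m2 *.
have [r0|r0] := leP 0 r.
- by rewrite ger0_norm//; nra.
- by rewrite ltr0_norm//; nra.
Qed.

(** Multiplying a Gamma variable of parameter [om + 1/2] by an independent Beta([om], 1/2) variable
    gives a Gamma variable of parameter [om]. Concretely, [e^{v + softplus r} = e^v + e^{r + v}]
    makes the integrand split into [loggamma om v] and a normalized translate of [loggamma 2^-1]. *)
Lemma logconv_beta (om v : R) :
  logconv (betakernel om) (fun r => - softplus r) (loggamma (om + 2^-1)) v =
  loggamma om v.
Proof.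
have I0 := Rintegral_loggamma_gt0 half_gt0.
set I := \int[mu]_v _ in I0.
transitivity (\int[mu]_r (loggamma om v * I^-1 * loggamma 2^-1 (r + v))).
  apply: eq_Rintegral => r _; rewrite /betakernel -/I /loggamma opprK.
  have -> : expR (v + softplus r) = expR v + expR (r + v).
    by rewrite expRD expR_softplus mulrDr mulr1 -expRD [v + r]addrC.
  rewrite -[LHS]mulrA -expRD [RHS]mulrAC -expRD [RHS]mulrC.
  by congr (_ * expR _); field.
rewrite RintegralZl//; last exact: (integ_translate v (integ_loggamma half_gt0)).
rewrite (Rintegral_translate v (measurable_loggamma 2^-1)) -/I.
by rewrite divfK// gt_eqF.
Qed.

(** No Beta integral is computed: the transform is read off [logconv_beta] by the convolution
    theorem, dividing by a Gamma value that [Gamma_neq0] keeps away from zero. *)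
Lemma ltransform_beta (s om t : R) : s < om ->
  ltransform (betakernel om) (fun r => - softplus r) s t =
  Gamma (om%:C%C - (s +i* t)%C) / Gamma ((om + 2^-1)%:C%C - (s +i* t)%C).
Proof.
move=> som; have som' : s < om + 2^-1 by rewrite (lt_trans som)// ltrDl half_gt0.
have := ltransform_logconv (kernel_beta som) (density_loggamma som') t.
rewrite (_ : logconv _ _ _ = loggamma om); last first.
  by apply/funext => v; exact: logconv_beta.
rewrite !ltransform_loggamma// => ->; rewrite mulrAC mulfV ?mul1r//.
by apply: Gamma_neq0; rewrite /= subr_gt0.
Qed.

End BetaKernel.

(** * Convolution powers of the SNR law and their distribution functions *)

Section OutageLaw.
Variable R : realType.
Local Notation mR := (measurableTypeR R).
Local Notation mu := (@lebesgue_measure R).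
Variables a b om : R.

Definition snr_law : R -> R := logconv (betakernel om) (fun r => - softplus r)
  (logconv (loggamma b) id (loggamma a)).

Definition snr_mellin (s t : R) : R[i] :=
  Gamma (a%:C%C - (s +i* t)%C) * Gamma (b%:C%C - (s +i* t)%C) *
  (Gamma (om%:C%C - (s +i* t)%C) / Gamma ((om + 2^-1)%:C%C - (s +i* t)%C)).

Lemma density_snr_law s : s < a -> s < b -> s < om -> density_at s snr_law.
Proof.
move=> sa sb som; apply: density_logconv; first exact: kernel_beta.
apply: density_logconv; last exact: density_loggamma.
exact/density_kernel/density_loggamma.
Qed.

Lemma ltransform_snr_law s t : s < a -> s < b -> s < om ->
  ltransform snr_law id s t = snr_mellin s t.
Proof.
move=> sa sb som; have ka := density_loggamma sa.
have kb := density_kernel (density_loggamma sb).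
rewrite /snr_law ltransform_logconv; [|exact: kernel_beta|exact: density_logconv].
by rewrite ltransform_logconv// ltransform_beta// !ltransform_loggamma.
Qed.

Lemma inversion_snr_law s : s < a -> s < b -> s < om ->
  inversion_at s (snr_mellin s) snr_law.
Proof.
move=> sa sb som; have ka := density_loggamma sa.
have kb := density_kernel (density_loggamma sb).
have := inversion_logconv (kernel_beta som) (density_logconv kb ka)
  (inversion_logconv kb ka (cahen_mellin sa)).
congr (inversion_at _ _ _); apply/funext => t.
by rewrite ltransform_beta// ltransform_loggamma.
Qed.

(** The mass that the [n]-fold convolution power of the unnormalized [snr_law] puts strictly below
    [V]; for [n = 0] that power is the unit mass at 0. *)
Fixpoint cdf_law (n : nat) : R -> R :=
  if n is m.+1 then logconv snr_law id (cdf_law m) else fun V => (0 < V)%R%:R.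

Hypotheses (a0 : 0 < a) (b0 : 0 < b) (om0 : 0 < om).

Lemma snr_law_ge0 v : 0 <= snr_law v.
Proof. by have [] := density_snr_law a0 b0 om0. Qed.

Lemma measurable_snr_law : measurable_fun [set: mR] (snr_law : mR -> R).
Proof. by have [] := density_snr_law a0 b0 om0. Qed.

Lemma kernel_gt0 (s : R) : 0 < s -> kernel_at s (fun r => (0 < r)%R%:R) id.
Proof.
move=> s0; split; [by move=> r; rewrite ler0n|exact: measurable_gt0| |].
  exact: measurable_id.
exact: integ_gt0_exp.
Qed.

Lemma cdf_law1E V : (\int[mu]_r (snr_law r * cdf_law 0 (V - r))%:E =
  \int[mu]_r ((0 < r)%R%:R * snr_law (V - r))%:E)%E.
Proof.
rewrite -(@ge0_integral_reflect _ V (fun r => ((0 < r)%R%:R * snr_law (V - r))%:E)).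
- by apply: eq_integral => r _ /=; rewrite subKr mulrC.
- apply/measurable_EFinP; apply: measurable_funM; first exact: measurable_gt0.
  by apply: (measurableT_comp measurable_snr_law); meas.
- by move=> r; rewrite lee_fin mulr_ge0 ?snr_law_ge0.
Qed.

(** Exchanges kernel and density. The inversion has to start from [snr_law], whose transform is
    integrable on the line; the transform [1 / s] of the half-line is not. *)
Lemma cdf_law1 : cdf_law 1 = logconv (fun r => (0 < r)%R%:R) id snr_law.
Proof. by apply/funext => V; congr fine; exact: cdf_law1E. Qed.

Lemma cdf_law_pair s n : 0 < s -> s < a -> s < b -> s < om ->
  density_at s (cdf_law n.+1) /\
  inversion_at s (fun t => snr_mellin s t ^+ n.+1 * ((s +i* t)%C)^-1) (cdf_law n.+1).
Proof.
move=> s0 sa sb som; have dF := density_snr_law sa sb som.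
have k0 := kernel_gt0 s0; elim: n => [|n [IHd IHi]].
  rewrite cdf_law1; split; first exact: density_logconv.
  have := inversion_logconv k0 dF (inversion_snr_law sa sb som).
  by congr (inversion_at _ _ _); apply/funext => t;
    rewrite expr1 /ltransform Cint_laplace.
have kF := density_kernel dF; split; first exact: (density_logconv kF IHd).
have := inversion_logconv kF IHd IHi.
congr (inversion_at _ _ _); apply/funext => t.
by rewrite ltransform_snr_law// [in RHS]exprSr mulrAC.
Qed.

Lemma strip_point : exists s, [/\ 0 < s, s < a, s < b & s < om].
Proof.
have m0 : 0 < Num.min (Num.min a b) om by rewrite !lt_min a0 b0.
exists (Num.min (Num.min a b) om / 2); rewrite divr_gt0//.
have : Num.min (Num.min a b) om / 2 < Num.min (Num.min a b) om by lra.
by rewrite !lt_min => /andP[/andP[? ?] ?].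
Qed.

Lemma integral_cdf_law n V :
  (\int[mu]_r (snr_law r * cdf_law n (V - r))%:E = (cdf_law n.+1 V)%:E)%E.
Proof.
have [s [s0 sa sb som]] := strip_point.
have dF := density_snr_law sa sb som.
case: n => [|n]; last first.
  have [dE _] := cdf_law_pair n s0 sa sb som.
  rewrite -[LHS]fineK//; apply: (integrable_fin_num measurableT).
  exact: (integ_logconv_integrand (density_kernel dF) dE).
rewrite cdf_law1 cdf_law1E -[LHS]fineK//; apply: (integrable_fin_num measurableT).
exact: (integ_logconv_integrand (kernel_gt0 s0) dF).
Qed.

Lemma cdf_law_ge0 n V : 0 <= cdf_law n V.
Proof.
elim: n V => [|n IH] V /=; first by rewrite ler0n.
by apply: logconv_ge0 => //; exact: snr_law_ge0.
Qed.

End OutageLaw.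

(** * Evaluation of the Meijer functions *)

Section MeijerEvaluation.
Variable R : realType.
Local Notation mR := (measurableTypeR R).
Local Notation mu := (@lebesgue_measure R).

Lemma vertical_integral_inversion (s v : R) (psi : R -> R[i]) (H : R -> R)
    (F : R[i] -> R[i]) : inversion_at s psi H ->
  (forall t, F (s +i* t)%C = psi t * cexp ((s +i* t)%C * v%:C%C)) ->
  vertical_integral s F = (H v)%:C%C.
Proof.
move=> [ipsi inv] FE; rewrite /vertical_integral.
set i := Num.imaginary; have i0 : i != 0 by exact: neq0Ci.
have pi0 : (2 * pi : R)%:C%C != 0.
  by apply/eqP => /(congr1 (@complex.Re R))/= /eqP; rewrite gt_eqF// mulr_gt0// pi_gt0.
rewrite -[cintegral _ _]/(Cint _).
rewrite (@eq_Cint _ _ (fun t => i * (psi t * cexp ((s +i* t)%C * v%:C%C)))); last first.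
  by move=> t; rewrite FE mulrC.
rewrite CintZ; last first.
  apply: (cinteg_le _ (integZ (expR (s * v)) (integ_normc ipsi))).
    apply: cmeasurableM; first exact: cinteg_measurable.
    apply: cmeasurable_cexp; apply: cmeasurableM; last exact: cmeasurable_cst.
    by apply: cmeasurable_complex; meas.
  by move=> t; rewrite ComplexField.Normc.normcM normc_line_cexpV mulrC.
rewrite inv (realcM (2 * pi)) (_ : i * _ = (2 * pi)%:C%C * i * (H v)%:C%C); last first.
  by rewrite mulrCA mulrA.
by rewrite mulKf// mulf_neq0.
Qed.

Lemma cpow_line (x : R) (s : R[i]) : cpow x s = cexp (s * (ln x)%:C%C).
Proof. by []. Qed.

Lemma meijerG_snr (a b om x : R) :
  meijerG 3 0 [:: om + 2^-1] [:: a; b; om] x = (snr_law a b om (ln x))%:C%C.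
Proof.
rewrite /meijerG; set P := [set _ | _].
(* Exhibiting one abscissa below all three parameters shows that the unspecified one chosen by
   [xget] separates the poles as well; its instance [k = 0] then gives the bounds that the inversion
   requires. *)
have : P (xget 0 P).
  apply: xgetPex; exists (Num.min (Num.min a b) om - 1) => k /=; split => // c.
  rewrite !inE; have k0 : 0 <= k%:R :> R by [].
  have [m1 m2 m3] : [/\ Num.min (Num.min a b) om <= a,
      Num.min (Num.min a b) om <= b & Num.min (Num.min a b) om <= om].
    by split; rewrite !ge_min lexx ?orbT.
  by move=> /or3P[] /eqP ->; lra.
set s := xget _ _ => /(_ 0%N)[/= sP _].
have sa : s < a by have := sP a; rewrite addr0; apply; rewrite inE eqxx.
have sb : s < b by have := sP b; rewrite addr0; apply; rewrite !inE eqxx orbT.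
have som : s < om by have := sP om; rewrite addr0; apply; rewrite !inE eqxx !orbT.
apply: (vertical_integral_inversion (inversion_snr_law sa sb som)) => t.
rewrite /meijerG_integrand /= !big_cons !big_nil !mulr1 mul1r /snr_mellin.
by rewrite cpow_line !mulrA.
Qed.

Lemma bigprod_nseq n (c : R) (f : R -> R[i]) :
  \prod_(x <- nseq n c) f x = f c ^+ n.
Proof. by rewrite big_nseq iter_mulr_1. Qed.

Lemma bigprod_cat (s1 s2 : seq R) (f : R -> R[i]) :
  \prod_(x <- s1 ++ s2) f x = (\prod_(x <- s1) f x) * \prod_(x <- s2) f x.
Proof. by rewrite big_cat. Qed.

Lemma meijerG_cdf (n : nat) (a b om x : R) : 0 < a -> 0 < b -> 0 < om ->
  meijerG (3 * n.+1) 1 (1 :: nseq n.+1 (om + 2^-1))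
    (nseq n.+1 a ++ nseq n.+1 b ++ nseq n.+1 om ++ [:: 0]) x =
  (cdf_law a b om n.+1 (ln x))%:C%C.
Proof.
move=> a0 b0 om0; set B := _ ++ _.
have BE : B = (nseq n.+1 a ++ nseq n.+1 b ++ nseq n.+1 om) ++ [:: 0].
  by rewrite /B !catA.
have sB : size (nseq n.+1 a ++ nseq n.+1 b ++ nseq n.+1 om) = (3 * n.+1)%N.
  by rewrite !size_cat !size_nseq !mulSn mul0n addn0.
have tB : take (3 * n.+1) B = nseq n.+1 a ++ nseq n.+1 b ++ nseq n.+1 om.
  by rewrite BE take_size_cat.
have dB : drop (3 * n.+1) B = [:: 0] by rewrite BE drop_size_cat.
rewrite /meijerG; set P := [set _ | _].
have : P (xget 0 P).
  have [s [s0 sa sb som]] := strip_point a0 b0 om0.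
  apply: xgetPex; exists s => k; rewrite tB.
  have k0 : 0 <= k%:R :> R by [].
  split => c; last by rewrite /= ?take0 inE => /eqP ->; lra.
  by rewrite !mem_cat !mem_nseq /= => /or3P[] /eqP ->; lra.
set s := xget _ _ => /(_ 0%N)[]; rewrite tB => sP /(_ 1).
(* The upper parameter 1 contributes the pole of [Gamma s] at 0, which forces the abscissa to be
   positive. *)
rewrite /= ?take0 inE eqxx => /(_ isT); rewrite subrr subr0 => s0.
have sa : s < a by have := sP a; rewrite addr0; apply; rewrite !mem_cat !mem_nseq eqxx.
have sb : s < b.
  by have := sP b; rewrite addr0; apply; rewrite !mem_cat !mem_nseq eqxx orbT.
have som : s < om.
  by have := sP om; rewrite addr0; apply; rewrite !mem_cat !mem_nseq eqxx !orbT.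
have [_ pr] := cdf_law_pair a0 b0 om0 n s0 sa sb som.
apply: (vertical_integral_inversion pr) => t.
rewrite /meijerG_integrand tB dB.
have -> : take 1 (1 :: nseq n.+1 (om + 2^-1)) = [:: 1 : R] by rewrite /= ?take0.
have -> : drop 1 (1 :: nseq n.+1 (om + 2^-1)) = nseq n.+1 (om + 2^-1).
  by rewrite /= ?drop0.
rewrite !bigprod_cat !bigprod_nseq !big_seq1 cpow_line.
rewrite (_ : 1 - 1%:C%C + (s +i* t)%C = (s +i* t)%C); last first.
  by rewrite (_ : 1%:C%C = 1)// subrr add0r.
rewrite (_ : 1 - 0%:C%C + (s +i* t)%C = (s +i* t)%C + 1); last first.
  by rewrite (_ : 0%:C%C = 0)// subr0 addrC.
(* [Gamma s] now stands above and below; cancelling it to leave [1 / s] relies on its being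
   nonzero. *)
rewrite GammaS// /snr_mellin; congr (_ * _).
have G0 : Gamma (s +i* t)%C != 0 by apply: Gamma_neq0.
have G1 : Gamma ((om + 2^-1)%:C%C - (s +i* t)%C) != 0.
  by apply: Gamma_neq0; rewrite /= subr_gt0 (lt_trans som)// ltrDl invr_gt0.
have st0 : (s +i* t)%C != 0.
  by apply/eqP => /(congr1 (@complex.Re R))/= /eqP; rewrite gt_eqF.
set z := (s +i* t)%C in G0 G1 st0 *; set g0 := Gamma z in G0 *.
set ga := Gamma (a%:C%C - z); set gb := Gamma (b%:C%C - z).
set go := Gamma (om%:C%C - z); set g1 := Gamma ((om + 2^-1)%:C%C - z) in G1 *.
clearbody g0 ga gb go g1; rewrite !exprMn exprVn.
have : g1 ^+ n.+1 != 0 by rewrite expf_neq0.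
move: (ga ^+ _) (gb ^+ _) (go ^+ _) (g1 ^+ _) => x1 x2 x3 x4 x40.
by field; rewrite st0 G0 x40.
Qed.

End MeijerEvaluation.

Lemma big_tcons d (T : measurableType d) (S : Type) (idx : S) (op : S -> S -> S)
    (n : nat) (g : T -> S) (p : T * n.-tuple T) :
  \big[op/idx]_(m < n.+1) g (tnth (tcons p) m) =
  op (g p.1) (\big[op/idx]_(m < n) g (tnth p.2 m)).
Proof. by rewrite -(big_tuple _ _ (tcons p) xpredT g) big_cons big_tuple. Qed.

(** * Integration of the product density over tuples *)

Section TupleIntegral.
Variable R : realType.
Local Notation mR := (measurableTypeR R).
Local Notation mu := (@lebesgue_measure R).
Variables (a b om : R) (K c0 : R).
Hypotheses (a0 : 0 < a) (b0 : 0 < b) (om0 : 0 < om) (K0 : 0 <= K).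

(** [expR (- ln x)] is [1 / x]; [c0] collects the logarithms of the constants in the Meijer
    argument, and the [ln x / 2] comes from its square root. *)
Definition snr_pdf (x : R) : R :=
  (0 < x)%R%:R * (K * expR (- ln x) / 2 * snr_law a b om (c0 + ln x / 2)).

Lemma snr_pdf_ge0 x : 0 <= snr_pdf x.
Proof. by rewrite !mulr_ge0 ?expR_ge0 ?snr_law_ge0. Qed.

Lemma measurable_snr_pdf : measurable_fun [set: mR] (snr_pdf : mR -> R).
Proof.
rewrite /snr_pdf; apply: measurable_funM; first exact: measurable_gt0.
apply: measurable_funM; first by meas.
by apply: (measurableT_comp (measurable_snr_law a0 b0 om0)); meas.
Qed.

Lemma measurable_cdf_law n : measurable_fun [set: mR] (cdf_law a b om n : mR -> R).
Proof.
case: n => [|n]; first exact: measurable_gt0.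
have [s [s0 sa sb som]] := strip_point a0 b0 om0.
by have [[]] := cdf_law_pair a0 b0 om0 n s0 sa sb som.
Qed.

(** The last factor is the indicator of [prod x_m < e^V] in logarithmic form, so that splitting off
    one coordinate merely lowers [V] by its logarithm. *)
Definition product_integrand n (V : R) (t : n.-tuple mR) : R :=
  (\prod_(m < n) snr_pdf (tnth t m)) * (0 < V - \sum_(m < n) ln (tnth t m))%R%:R.

Lemma product_integrand_ge0 n V t : 0 <= @product_integrand n V t.
Proof. by rewrite mulr_ge0// prodr_ge0// => m _; exact: snr_pdf_ge0. Qed.

Lemma measurable_product_integrand n V :
  measurable_fun [set: n.-tuple mR] (product_integrand V).
Proof.
apply: measurable_funM.
  apply: measurable_prod => m _.
  exact: (measurableT_comp measurable_snr_pdf (measurable_tnth m)).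
apply: (measurableT_comp (@measurable_gt0 R)); apply: measurable_funB.
  exact: measurable_cst.
apply: measurable_sum => m.
exact: (measurableT_comp (@measurable_ln R) (measurable_tnth m)).
Qed.

Lemma product_integrand_cons n V (p : mR * n.-tuple mR) :
  product_integrand V (tcons p) = snr_pdf p.1 * product_integrand (V - ln p.1) p.2.
Proof.
by rewrite /product_integrand big_tcons [X in V - X]big_tcons opprD addrA mulrA.
Qed.

(** By Tonelli, integrating out the first coordinate reproduces the recursion of [cdf_law]. Each
    coordinate enters through [c0 + ln x / 2], so the condition [sum ln x_m < V] puts the sum of
    these terms below [n c0 + V / 2]. *)
Lemma integral_product_integrand n V :
  (\int[lebesgue_tuple R n]_t (product_integrand V t)%:E =
   (K ^+ n * cdf_law a b om n (n%:R * c0 + V / 2))%:E)%E.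
Proof.
elim: n V => [|n IH] V.
  rewrite [lebesgue_tuple R 0]/= integral_dirac//; last first.
    by apply/measurable_EFinP; exact: measurable_product_integrand.
  rewrite diracT mul1e /product_integrand !big_ord0 mul1r subr0 expr0 mul1r mul0r add0r /=.
  by rewrite pmulr_lgt0.
have mc := measurable_cdf_law n.
rewrite [lebesgue_tuple R n.+1]/= /tcons_measure.
rewrite ge0_integral_pushforward//; last 3 first.
- exact: measurable_tcons.
- by apply/measurable_EFinP; exact: measurable_product_integrand.
- by move=> t _; rewrite lee_fin product_integrand_ge0.
rewrite preimage_setT fubini_tonelli1; last 2 first.
- apply/measurable_EFinP.
  apply: (measurableT_comp (measurable_product_integrand V)).
  exact: measurable_tcons.
- by move=> p; rewrite lee_fin product_integrand_ge0.
transitivity (\int[mu]_x ((0 < x)%R%:R * (K ^+ n * (K * expR (- ln x) / 2 *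
    snr_law a b om (c0 + ln x / 2) *
    cdf_law a b om n (n%:R * c0 + (V - ln x) / 2))))%:E)%E.
  apply: eq_integral => x _; rewrite /fubini_F /=.
  under eq_integral do rewrite product_integrand_cons EFinM /=.
  rewrite ge0_integralZl//; last 3 first.
  - by apply/measurable_EFinP; exact: measurable_product_integrand.
  - by move=> t _; rewrite lee_fin product_integrand_ge0.
  - by rewrite lee_fin snr_pdf_ge0.
  by rewrite IH -EFinM /snr_pdf; congr EFin; ring.
have ms := measurable_snr_law a0 b0 om0.
rewrite -integral_gt0 ge0_integral_expR; last 2 first.
- apply: measurable_funM; first exact: measurable_cst.
  apply: measurable_funM; last by apply: (measurableT_comp mc); meas.
  apply: measurable_funM; last by apply: (measurableT_comp ms); meas.
  by meas.
- by move=> x; rewrite !mulr_ge0 ?exprn_ge0 ?expR_ge0 ?snr_law_ge0 ?cdf_law_ge0.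
have h0 : 0 < 2^-1 :> R by rewrite invr_gt0.
set V' := n.+1%:R * c0 + V / 2.
(* The Jacobian [e^v] has cancelled the [1 / x]. The remaining 1/2 is the Jacobian of
   [r = v / 2 + c0], after which the integral is the convolution at [V']. *)
transitivity (\int[mu]_v ((2^-1)%:E * (K ^+ n.+1 * (snr_law a b om (2^-1 * v + c0) *
    cdf_law a b om n (V' - (2^-1 * v + c0))))%:E))%E.
  apply: eq_integral => v _; rewrite expRK -EFinM; congr EFin.
  rewrite (_ : V' - _ = n%:R * c0 + (V - v) / 2); last first.
    by rewrite /V' -natr1; ring.
  rewrite (_ : c0 + v / 2 = 2^-1 * v + c0); last by ring.
  by rewrite exprS expRN; field; rewrite gt_eqF ?expR_gt0.
pose f r := (K ^+ n.+1 * (snr_law a b om r * cdf_law a b om n (V' - r)))%:E.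
have mf0 : measurable_fun [set: mR] (fun r => snr_law a b om r * cdf_law a b om n
  (V' - r)).
  by apply: measurable_funM => //; apply: (measurableT_comp mc); meas.
have mf : measurable_fun [set: mR] f.
  by apply/measurable_EFinP; apply: measurable_funM => //; exact: measurable_cst.
have f0 r : (0 <= f r)%E.
  by rewrite lee_fin !mulr_ge0 ?exprn_ge0 ?snr_law_ge0 ?cdf_law_ge0.
rewrite ge0_integralZl//; last 2 first.
- by apply: (measurableT_comp mf); meas.
- by move=> v _; exact: (f0 (2^-1 * v + c0)).
rewrite -(ge0_integral_affine c0 h0 mf f0) /f.
under eq_integral do rewrite EFinM.
rewrite ge0_integralZl//; last 3 first.
- exact/measurable_EFinP.
- by move=> r _; rewrite lee_fin mulr_ge0 ?snr_law_ge0 ?cdf_law_ge0.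
- by rewrite lee_fin exprn_ge0.
by rewrite integral_cdf_law.
Qed.

End TupleIntegral.

(** * The outage event *)

Section OutageEvent.
Variable R : realType.

Lemma ln_le_sub1 (x : R) : 0 < x -> ln x <= x - 1.
Proof.
move=> x0; have := @le_ln1Dx R (x - 1); rewrite [1 + _]addrC subrK; apply.
by rewrite ltrBrDr addrC subrr.
Qed.

(* ln (1 + c e^y) is a convex function of y; this is its tangent at y = ln th. *)
Lemma ln_tangent (c th x : R) : 0 < c -> 0 < th -> 0 < x ->
  ln (1 + c * th) + c * th / (1 + c * th) * (ln x - ln th) <= ln (1 + c * x).
Proof.
move=> c0 th0 x0; have ct : 0 < 1 + c * th by rewrite addr_gt0// mulr_gt0.
have cx : 0 < 1 + c * x by rewrite addr_gt0// mulr_gt0.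
pose m := (1 + c * x) / (1 + c * th); have m0 : 0 < m by rewrite divr_gt0.
have lm : ln m = ln (1 + c * x) - ln (1 + c * th) by rewrite ln_div.
have h1 : ln x - ln th - ln m <= x / th / m - 1.
  by rewrite -!ln_div ?posrE ?divr_gt0//; apply: ln_le_sub1; rewrite !divr_gt0.
have h2 : - ln m <= m^-1 - 1.
  by rewrite -lnV ?posrE//; apply: ln_le_sub1; rewrite invr_gt0.
(* [m] is the mean of [x / th] and 1 with weights [p] and [1 - p]. Averaging [h1] and [h2] with
   these weights makes the right-hand sides cancel: Jensen's inequality for [ln]. *)
pose p := c * th / (1 + c * th); have p0 : 0 <= p.
  by rewrite divr_ge0 ?mulr_ge0 ?ltW.
have q0 : 0 <= 1 - p.
  by rewrite subr_ge0 ler_pdivrMr// mul1r lerDr.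
have e : p * (x / th / m - 1) + (1 - p) * (m^-1 - 1) = 0.
  by rewrite /p /m; field; rewrite !gt_eqF.
have := lerD (ler_wpM2l p0 h1) (ler_wpM2l q0 h2); rewrite e -/p lm; nra.
Qed.

(** By contraposition. Summing the tangent inequalities, the constant terms add up to [rt] by the
    choice of [th], and the linear terms are nonnegative as soon as the logarithms of the [x m]
    average at least [ln th]. *)
Lemma outage_log_bound (n : nat) (c th rt : R) (x : 'I_n.+1 -> R) :
  0 < c -> 0 < th -> ln (1 + c * th) = rt / n.+1%:R -> (forall m, 0 < x m) ->
  \sum_(m < n.+1) ln (1 + c * x m) < rt ->
  \sum_(m < n.+1) ln (x m) < n.+1%:R * ln th.
Proof.
move=> c0 th0 lth x0; apply: contraTT; rewrite -!leNgt => hx.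
have ct : 0 < 1 + c * th by rewrite addr_gt0// mulr_gt0.
pose p := c * th / (1 + c * th); have p0 : 0 <= p.
  by rewrite divr_ge0 ?mulr_ge0 ?ltW.
apply: (@le_trans _ _ (\sum_(m < n.+1) (ln (1 + c * th) + p * (ln (x m) - ln th)))).
  rewrite big_split/= sumr_const card_ord lth -mulr_sumr sumrB sumr_const card_ord.
  rewrite -[_ / _ *+ _]mulr_natr divfK ?pnatr_eq0// lerDl mulr_ge0// subr_ge0.
  by rewrite -[ln th *+ _]mulr_natl.
by apply: ler_sum => m _; exact: ln_tangent.
Qed.

End OutageEvent.

(** * Real forms of the density and of the bound *)

Section OutageBound.
Variable R : realType.
Local Notation mR := (measurableTypeR R).
Local Notation mu := (@lebesgue_measure R).
Local Notation c := (@capacity_const R).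

Lemma capacity_const_gt0 : 0 < c.
Proof. by rewrite divr_gt0 ?expR_gt0// mulr_gt0// pi_gt0. Qed.

Lemma ln_sqrt (x : R) : 0 < x -> ln (Num.sqrt x) = ln x / 2.
Proof. by move=> x0; rewrite -powR12_sqrt ?ltW// ln_powR mulrC. Qed.

Lemma log2E (y : R) : ln y = log2 y * ln 2.
Proof. by rewrite /log2 divfK// gt_eqF// ln_gt0// ltr1n. Qed.

Lemma powR2_gt1 (y : R) : 0 < y -> 1 < 2 `^ y.
Proof.
by move=> y0; rewrite /powR pnatr_eq0/= expR_gt1 mulr_gt0// ln_gt0// ltr1n.
Qed.

Definition snr_scale (alpha beta om : R) : R := Num.sqrt om /
  ((\int[mu]_v loggamma alpha v) * (\int[mu]_v loggamma beta v)).

Lemma snr_scaleE (alpha beta om : R) : 0 < alpha -> 0 < beta ->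
  (snr_scale alpha beta om)%:C%C =
  (Num.sqrt om)%:C%C / (Gamma alpha%:C%C * Gamma beta%:C%C).
Proof. by move=> a0 b0; rewrite !Gamma_real// -realcM -realcV -realcM. Qed.

Lemma snr_scale_ge0 (alpha beta om : R) : 0 < alpha -> 0 < beta ->
  0 <= snr_scale alpha beta om.
Proof.
move=> a0 b0; rewrite divr_ge0 ?sqrtr_ge0// mulr_ge0// ltW//;
  exact: Rintegral_loggamma_gt0.
Qed.

Lemma snr_densityE (alpha beta om A0 hl gbar x : R) :
  0 < alpha -> 0 < beta -> 0 < om -> 0 < A0 -> 0 < hl -> 0 < gbar -> 0 < x ->
  snr_density alpha beta om A0 hl gbar x =
  snr_pdf alpha beta om (snr_scale alpha beta om)
    (ln (alpha * beta / (A0 * hl)) - ln gbar / 2) x.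
Proof.
move=> a0 b0 om0 A00 hl0 g0 x0; rewrite /snr_density meijerG_snr.
have kap0 : 0 < alpha * beta / (A0 * hl) by rewrite divr_gt0 ?mulr_gt0.
set kap := alpha * beta / (A0 * hl) in kap0 *; clearbody kap.
rewrite (lnM (x := kap)) ?posrE ?sqrtr_gt0 ?divr_gt0// ln_sqrt ?divr_gt0// ln_div//.
rewrite -[(2 * x)%:C%C * _ * _]mulrA invfM mulrCA -snr_scaleE// -realcV -!realcM ReC.
rewrite /snr_pdf x0 mul1r expRN lnK; last by rewrite posrE.
rewrite (_ : ln kap + _ = ln kap - ln gbar / 2 + ln x / 2); last by ring.
by rewrite invfM; ring.
Qed.

Lemma outage_ir_ubE (n : nat) (alpha beta om A0 hl gbar Rt : R) :
  0 < alpha -> 0 < beta -> 0 < om -> 0 < A0 -> 0 < hl -> 0 < gbar -> 0 < Rt ->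
  outage_ir_ub n.+1 alpha beta om A0 hl gbar Rt =
  snr_scale alpha beta om ^+ n.+1 * cdf_law alpha beta om n.+1
    (n.+1%:R * (ln (alpha * beta / (A0 * hl)) - ln gbar / 2) +
     n.+1%:R * ln ((2 `^ (2 * Rt / n.+1%:R) - 1) / c) / 2).
Proof.
move=> a0 b0 om0 A00 hl0 g0 rt0; rewrite /outage_ir_ub meijerG_cdf//.
have kap0 : 0 < alpha * beta / (A0 * hl) by rewrite divr_gt0 ?mulr_gt0.
set kap := alpha * beta / (A0 * hl) in kap0 *; clearbody kap.
set th := (_ - 1) / c; have th0 : 0 < th.
  by rewrite divr_gt0 ?capacity_const_gt0// subr_gt0 powR2_gt1// divr_gt0// mulr_gt0.
rewrite -snr_scaleE// -rmorphXn -realcM ReC; congr (_ * cdf_law _ _ _ _ _).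
rewrite (_ : _ / (c * gbar) = th / gbar); last by rewrite /th invfM mulrA.
clearbody th.
rewrite lnXn; last by rewrite mulr_gt0// sqrtr_gt0 divr_gt0.
rewrite (lnM (x := kap)) ?posrE ?sqrtr_gt0 ?divr_gt0// ln_sqrt ?divr_gt0// ln_div//.
by rewrite -mulr_natl; ring.
Qed.

(** The event is the level set at 1 of a product of indicators, each a measurable function of the
    tuple. *)
Lemma measurable_outage_event n (rt : R) : measurable
  [set x : n.-tuple mR | (forall m : 'I_n, 0 < tnth x m) /\
    \sum_(m < n) log2 (1 + c * tnth x m) < rt].
Proof.
pose h (x : n.-tuple mR) : R := (\prod_(m < n) (0 < tnth x m)%R%:R) *
  (0 < rt - \sum_(m < n) log2 (1 + c * tnth x m))%R%:R.
have mh : measurable_fun setT h.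
  apply: measurable_funM.
    apply: measurable_prod => m _.
    exact: (measurableT_comp (@measurable_gt0 R) (measurable_tnth m)).
  apply: (measurableT_comp (@measurable_gt0 R)); apply: measurable_funB.
    exact: measurable_cst.
  apply: measurable_sum => m; rewrite /log2.
  apply: (measurableT_comp (f := fun y : mR => ln (1 + c * y) / ln 2)).
    by meas.
  exact: measurable_tnth.
rewrite (_ : [set x | _] = setT `&` h @^-1` [set 1]).
  exact: mh.
rewrite setTI; apply/seteqP; split => x /=.
  by move=> [x0 xr]; rewrite /h subr_gt0 xr mulr1 big1// => m _; rewrite x0.
rewrite /h subr_gt0 => h1; split.
  move=> m; apply/negPn/negP => xm; move: h1.
  by rewrite (bigD1 m)//= (negPf xm) !mul0r => /eqP; rewrite eq_sym oner_eq0.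
by case: ltP h1 => //; rewrite mulr0 => _ /eqP; rewrite eq_sym oner_eq0.
Qed.

End OutageBound.

Theorem proposition3 (R : realType) (M : nat)
    (alpha beta omega A0 hl gbar Rt : R) :
  (1 <= M)%N ->
  0 < alpha -> 0 < beta -> 0 < omega -> 0 < A0 -> 0 < hl -> 0 < gbar ->
  0 < Rt ->
  (outage_ir M alpha beta omega A0 hl gbar Rt
   <= (outage_ir_ub M alpha beta omega A0 hl gbar Rt)%:E)%E.
Proof.
case: M => // n _ a0 b0 om0 A00 hl0 g0 rt0.
have K0 := snr_scale_ge0 omega a0 b0.
set K := snr_scale alpha beta omega in K0.
pose c := @capacity_const R; have c0 : 0 < c by exact: capacity_const_gt0.
(* The common SNR at which [M] equal rounds reach the rate [2 * Rt] exactly; it is the point of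
   tangency. *)
pose th := (2 `^ (2 * Rt / n.+1%:R) - 1) / c.
have p1 : 1 < 2 `^ (2 * Rt / n.+1%:R) by rewrite powR2_gt1// divr_gt0// mulr_gt0.
have th0 : 0 < th by rewrite divr_gt0// subr_gt0.
have lth : ln (1 + c * th) = 2 * Rt * ln 2 / n.+1%:R.
  by rewrite /th mulrC divfK ?gt_eqF// addrC subrK ln_powR mulrAC.
set V := n.+1%:R * ln th.
rewrite outage_ir_ubE// -/K -/c -/th -/V -integral_product_integrand//.
set q := product_integrand _ _ _ _ _ _; rewrite /outage_ir /prob_iid.
set B := [set _ | _]; have mB : measurable B by exact: measurable_outage_event.
(* The bound is now the integral of [q] over all tuples. On the outage event the indicator inside
   [q] equals 1, so the outage probability is the integral of the same nonnegative [q] over a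
   smaller set. *)
rewrite (eq_integral (fun t => (q t)%:E)); last first.
  move=> t; rewrite inE => -[t0 tr]; congr EFin.
  rewrite /q /product_integrand subr_gt0 (_ : _ < V) ?mulr1; last first.
    apply: (outage_log_bound c0 th0 lth t0).
    rewrite (eq_bigr (fun m => log2 (1 + c * tnth t m) * ln 2)); last first.
      by move=> m _; exact: log2E.
    by rewrite -mulr_suml ltr_pM2r// ln_gt0// ltr1n.
  by apply: eq_bigr => m _; exact: snr_densityE.
apply: ge0_subset_integral => //.
- by apply/measurable_EFinP; exact: measurable_product_integrand.
- by move=> t _; rewrite lee_fin product_integrand_ge0.
Qed.
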